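(* Let $F\in L^2_\eta$ with a representative $f:\mathbf{N}\to\mathbb{R}$ and assume that there are $k\in\mathbb{N}$, $I_1,I_2\subset\{1,\ldots,k\}$ with $I_1\cup I_2=\{1,\ldots,k\}$, $U\subset\mathbb{X}^k$ measurable and $c>0$ such that $$\bigg|\mathbb{E}\bigg[f\Big(\eta+\sum_{i\in I_1}\delta_{x_i}\Big)-f\Big(\eta+\sum_{i\in I_2}\delta_{x_i}\Big)\bigg]\bigg|\ge c,\quad\lambda^k\text{-a.e. }(x_1,\ldots,x_k)\in U.$$ Then $$\operatorname{Var}F\ge\frac{c^2}{4^{k+1}k!}\min_{\emptyset\ne J\subset\{1,\ldots,k\}}\ \inf_{\substack{V\subset U\text{ measurable}\\ \lambda^k(V)\ge\lambda^k(U)/2^{k+1}}}\lambda^{|J|}(\Pi_J(V)),$$ where $\Pi_J$ stands for the projection onto the components whose indices belong to $J$.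
   Context: Let $(\mathbb{X},\mathcal{X})$ be a measurable space with a $\sigma$-finite measure $\lambda$, $\lambda(\mathbb{X})>0$. Let $\mathbf{N}$ be the space of integer-valued $\sigma$-finite measures on $\mathbb{X}$, with the smallest $\sigma$-field making all maps $\mu\mapsto\mu(B)$, $B\in\mathcal{X}$, measurable. Let $\eta$ be a Poisson process on $\mathbb{X}$ with intensity measure $\lambda$, a random element of $\mathbf{N}$. $L^2_\eta$ is the set of square-integrable random variables $F$ with $F=f(\eta)$ a.s. for some measurable $f:\mathbf{N}\to\mathbb{R}$ (a representative). $|J|$ is the cardinality of $J$. *)

(* Defs.v *)
From HB Require Import structures.
From mathcomp Require Import all_boot all_order all_algebra.
From mathcomp Require Import all_classical all_reals all_analysis.
From mathcomp Require Import measurable_realfun.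

Set Implicit Arguments.
Unset Strict Implicit.
Unset Printing Implicit Defensive.

Import Order.TTheory GRing.Theory Num.Theory.
Import numFieldNormedType.Exports.

Local Open Scope classical_set_scope.
Local Open Scope ring_scope.

(* The space N of integer-valued sigma-finite measures; +oo is an admissible
   value, only finite values are required to be integers. *)
Record point_measure d (X : measurableType d) (R : realType) := PointMeasure {
  point_measure_val :> {measure set X -> \bar R} ;
  point_measure_sigma_finite : sigma_finite setT point_measure_val ;
  point_measure_integer : forall B, measurable B ->
    (point_measure_val B < +oo)%E ->
    exists n : nat, point_measure_val B = n%:R%:E }.

Section point_measure_nmodule.
Context d (X : measurableType d) (R : realType).
Local Notation N := (point_measure X R).

Lemma point_measure_eq (m1 m2 : N) :
  (forall B, m1 B = m2 B) -> m1 = m2.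
Proof.
case: m1 m2 => [m1 s1 i1] [m2 s2 i2] /= h.
have m12 : m1 = m2 by apply: eq_measure; apply/funext.
move: s2 i2; rewrite -m12 => s2 i2.
by congr PointMeasure; exact: Prop_irrelevance.
Qed.

Lemma pm_zero_integer (B : set X) : measurable B -> (@mzero _ X R B < +oo)%E ->
  exists n : nat, @mzero _ X R B = n%:R%:E.
Proof. by move=> _ _; exists 0%N. Qed.

Definition pm_zero : N :=
  @PointMeasure d X R mzero (@sigma_finite_mzero d X R) pm_zero_integer.

Lemma pm_add_sigma_finite (m1 m2 : N) : sigma_finite setT (measure_add m1 m2).
Proof.
have /sigma_finiteP[F [TF ndF Foo]] := point_measure_sigma_finite m1.
have /sigma_finiteP[G [TG ndG Goo]] := point_measure_sigma_finite m2.
exists (fun n => F n `&` G n).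
  rewrite predeqE => x; split => // _.
  have [i _ Fi] : (\bigcup_i F i) x by rewrite -TF.
  have [j _ Gj] : (\bigcup_i G i) x by rewrite -TG.
  exists (maxn i j) => //; split.
  - by move: x Fi {Gj}; exact/subsetPset/ndF/leq_maxl.
  - by move: x Gj {Fi}; exact/subsetPset/ndG/leq_maxr.
move=> i; have [mF Fi] := Foo i; have [mG Gi] := Goo i.
have mFG : measurable (F i `&` G i) by exact: measurableI.
split=> //; rewrite measure_addE; apply: lte_add_pinfty.
- by apply: le_lt_trans Fi; rewrite le_measure ?inE//; exact: subIsetl.
- by apply: le_lt_trans Gi; rewrite le_measure ?inE//; exact: subIsetr.
Qed.

Lemma pm_add_integer (m1 m2 : N) B : measurable B ->
  (measure_add m1 m2 B < +oo)%E ->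
  exists n : nat, measure_add m1 m2 B = n%:R%:E.
Proof.
move=> mB; rewrite measure_addE => lt.
have [n1 e1] : exists n : nat, m1 B = n%:R%:E.
  apply: point_measure_integer => //; apply: le_lt_trans lt.
  by rewrite leeDl.
have [n2 e2] : exists n : nat, m2 B = n%:R%:E.
  apply: point_measure_integer => //; apply: le_lt_trans lt.
  by rewrite leeDr.
by exists (n1 + n2)%N; rewrite e1 e2 -EFinD natrD.
Qed.

Definition pm_add (m1 m2 : N) : N :=
  @PointMeasure d X R (measure_add m1 m2)
    (pm_add_sigma_finite m1 m2) (@pm_add_integer m1 m2).

Lemma pm_dirac_sigma_finite (x : X) : sigma_finite setT (@dirac _ X x R).
Proof.
apply: fin_num_fun_sigma_finite; first by rewrite dirac0.
by move=> B _; rewrite diracE.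
Qed.

Lemma pm_dirac_integer (x : X) (B : set X) :
  measurable B -> (@dirac _ X x R B < +oo)%E ->
  exists n : nat, @dirac _ X x R B = n%:R%:E.
Proof. by move=> _ _; exists (x \in B : nat); rewrite diracE. Qed.

Definition pm_dirac (x : X) : N :=
  @PointMeasure d X R (@dirac _ X x R)
    (pm_dirac_sigma_finite x) (@pm_dirac_integer x).

HB.instance Definition _ := gen_eqMixin N.
HB.instance Definition _ := gen_choiceMixin N.

Let pm_addE (m1 m2 : N) B : pm_add m1 m2 B = (m1 B + m2 B)%E.
Proof. exact: measure_addE. Qed.

Let pm_addA : associative pm_add.
Proof.
by move=> a b c; apply: point_measure_eq => B; rewrite !pm_addE addeA.
Qed.

Let pm_addC : commutative pm_add.
Proof.
by move=> a b; apply: point_measure_eq => B; rewrite !pm_addE addeC.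
Qed.

Let pm_add0 : left_id pm_zero pm_add.
Proof.
by move=> a; apply: point_measure_eq => B; rewrite pm_addE add0e.
Qed.

HB.instance Definition _ := GRing.isNmodule.Build N pm_addA pm_addC pm_add0.

Lemma point_measureD (m1 m2 : N) B : (m1 + m2) B = (m1 B + m2 B)%E.
Proof. exact: measure_addE. Qed.

Lemma point_measure_sum (I : finType) (A : {set I}) (m : I -> N) B :
  (\sum_(i in A) m i) B = (\sum_(i in A) m i B)%E.
Proof.
by apply: (big_morph (fun m : N => m B)) => // a b; exact: point_measureD.
Qed.

End point_measure_nmodule.

Arguments pm_dirac {d X R} x.

Section point_measure_measurable.
Context d (X : measurableType d) (R : realType).
Local Notation N := (point_measure X R).

HB.instance Definition _ := isPointed.Build N 0.

Definition preimg_pm_ev (B : set X) : set_system N :=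
  preimage_set_system [set: N] (fun m : N => m B) measurable.

Definition pm_measurable : set_system N :=
  <<s \bigcup_(B in measurable) preimg_pm_ev B >>.

Let pm_measurable0 : pm_measurable set0.
Proof. exact: sigma_algebra0. Qed.

Let pm_measurableC (U : set N) : pm_measurable U -> pm_measurable (~` U).
Proof. exact: sigma_algebraC. Qed.

Let pm_measurableU (F : (set N)^nat) :
  (forall i, pm_measurable (F i)) -> pm_measurable (\bigcup_i F i).
Proof. exact: sigma_algebra_bigcup. Qed.

Definition pm_display : measure_display.
Proof. by constructor. Qed.

HB.instance Definition _ := @isMeasurable.Build pm_display N pm_measurable
  pm_measurable0 pm_measurableC pm_measurableU.

End point_measure_measurable.

Section power_measure.
Context d (X : measurableType d) (R : realType).

Definition tuple_cons n (xt : X * n.-tuple X) : n.+1.-tuple X :=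
  [the n.+1.-tuple X of xt.1 :: xt.2].

Lemma measurable_tuple_cons n : measurable_fun setT (@tuple_cons n).
Proof. exact: measurable_cons. Qed.

Context (lambda : {sigma_finite_measure set X -> \bar R}).

Section step.
Context n (m : {sigma_finite_measure set (n.-tuple X) -> \bar R}).

Definition power_step := pushforward (lambda \x m)%E (@tuple_cons n).

Let power_step0 : power_step set0 = 0%E.
Proof. by rewrite /power_step /pushforward preimage_set0 measure0. Qed.

Let power_step_ge0 A : (0 <= power_step A)%E.
Proof. exact: (measure_ge0 (lambda \x m)%E). Qed.

Let power_step_sigma_additive : semi_sigma_additive power_step.
Proof.
have mcons A : measurable A -> measurable (@tuple_cons n @^-1` A).
  by move=> mA; rewrite -[X in measurable X]setTI; exact: measurable_tuple_cons.
move=> F mF tF mUF; rewrite /power_step /pushforward preimage_bigcup.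
apply: measure_semi_sigma_additive.
- by move=> i; exact: mcons.
- apply/trivIsetP => /= i j _ _ ij; rewrite -preimage_setI.
  by move/trivIsetP : tF => /(_ _ _ _ _ ij) ->//; rewrite preimage_set0.
- by rewrite -preimage_bigcup; exact: mcons.
Qed.

HB.instance Definition _ := isMeasure.Build _ _ _ power_step
  power_step0 power_step_ge0 power_step_sigma_additive.

Let power_step_sigma_finite : sigma_finite setT power_step.
Proof.
have /sigma_finiteP[F [TF ndF Foo]] := sigma_finiteT lambda.
have /sigma_finiteP[G [TG ndG Goo]] := sigma_finiteT m.
pose g (t : n.+1.-tuple X) : X * n.-tuple X := (thead t, [tuple of behead t]).
have mg : measurable_fun setT g.
  apply: measurable_fun_pair; last exact: measurable_behead.
  exact: measurable_tnth.
exists (fun i => g @^-1` (F i `*` G i)).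
  rewrite predeqE => t; split=> // _.
  have [i _ Fi] : (\bigcup_i F i) (g t).1 by rewrite -TF.
  have [j _ Gj] : (\bigcup_i G i) (g t).2 by rewrite -TG.
  exists (maxn i j) => //; split.
  - by move: (_.1) Fi; exact/subsetPset/ndF/leq_maxl.
  - by move: (_.2) Gj; exact/subsetPset/ndG/leq_maxr.
move=> i; have [mF Fi] := Foo i; have [mG Gi] := Goo i.
split.
  by rewrite -[X in measurable X]setTI; apply: mg => //; exact: measurableX.
rewrite /power_step /pushforward -comp_preimage.
have -> : g \o @tuple_cons n = id.
  apply/funext => -[x t]; rewrite /g /tuple_cons /= theadE.
  by congr pair; exact/val_inj.
by rewrite preimage_id product_measure1E// lte_mul_pinfty// ge0_fin_numE.
Qed.

HB.instance Definition _ := Measure_isSigmaFinite.Build _ _ _ power_step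
  power_step_sigma_finite.

End step.

(* The product measure lambda^n on the n-tuples, the n = 0 case being the unit
   mass at the empty tuple; power_measure_rect below characterizes it. *)
Fixpoint power_measure n : {sigma_finite_measure set (n.-tuple X) -> \bar R} :=
  match n with
  | 0 => dirac [tuple]
  | n'.+1 => power_step (power_measure n')
  end.

Lemma power_measure_rect n (B : 'I_n -> set X) :
  (forall i, measurable (B i)) ->
  power_measure n [set t | forall i, B i (tnth t i)] =
    (\prod_(i < n) lambda (B i))%E.
Proof.
elim: n B => [|n IH] B mB.
  by rewrite big_ord0 /= diracE mem_set// => -[].
rewrite big_ord_recl -(IH (fun i => B (lift ord0 i)))//.
have mrect : measurable
    [set t : n.-tuple X | forall i, B (lift ord0 i) (tnth t i)].
  rewrite (_ : [set t | _] =
    \bigcap_(i in [set: 'I_n]) ((@tnth n X ^~ i) @^-1` B (lift ord0 i))).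
    apply: fin_bigcap_measurable => // i _.
    by rewrite -[X in measurable X]setTI; exact: measurable_tnth.
  by apply/seteqP; split => [t ht i _|t ht i]; exact: ht.
rewrite /= /power_step /pushforward -product_measure1E//; congr (_ _).
apply/seteqP; split => [[x t] /= h|[x t] /= [h1 h2] i].
  split; first exact: (h ord0).
  by move=> i; have := h (lift ord0 i); rewrite tnthS.
case: (unliftP ord0 i) => [j ->|->//].
by rewrite tnthS; exact: h2.
Qed.

End power_measure.

(* Projection onto the coordinates in J, listed in increasing order. The image
   of a measurable set need not be measurable; it is measured with mu_ext, the
   outer measure, which agrees with the measure on measurable sets
   (measurable_mu_extE). *)
Definition tuple_proj (T : Type) k (J : {set 'I_k}) (x : k.-tuple T) :
    #|J|.-tuple T :=
  [tuple tnth x (enum_val i) | i < #|J|].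

Section poisson_process.
Context d d' (X : measurableType d) (Omega : measurableType d') (R : realType).

(* The Poisson distribution with parameter in [0, +oo], as a distribution on
   \bar R: Po(0) is the unit mass at 0 and Po(+oo) the unit mass at +oo. The
   second argument of poisson_prob is unused by that definition. *)
Definition poisson_law (r : \bar R) : set (\bar R) -> \bar R :=
  if r is rate%:E then
    fun A => poisson_prob rate 0%N [set n : nat | A n%:R%:E]
  else dirac +oo%E.

Definition independent_vars (P : probability Omega R) n
    (Y : 'I_n -> Omega -> \bar R) :=
  forall A : 'I_n -> set (\bar R), (forall i, measurable (A i)) ->
    P (\bigcap_(i in [set: 'I_n]) (Y i @^-1` A i)) =
      (\prod_(i < n) P (Y i @^-1` A i))%E.

Definition poisson_process (P : probability Omega R)
    (lambda : {measure set X -> \bar R})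
    (eta : {mfun Omega >-> point_measure X R}) : Prop :=
  (forall B, measurable B -> forall A, measurable A ->
     P [set w | A (eta w B)] = poisson_law (lambda B) A) /\
  (forall n (B : 'I_n -> set X), (forall i, measurable (B i)) ->
     trivIset setT B -> independent_vars P (fun i w => eta w (B i))).

End poisson_process.

(* Main.v *)
From HB Require Import structures.
From mathcomp Require Import all_boot all_order all_algebra.
From mathcomp Require Import all_classical all_reals all_analysis.
From mathcomp Require Import measurable_realfun.
From mathcomp Require Import ring lra.
Require Import Defs.

(** Let Q be the law of eta, let D_x f(mu) = f(mu + delta_x) - f(mu), and let
    u_n(y_1, ..., y_n) = E D_{y_1} ... D_{y_n} f(eta) (mean_diff). The theorem
    follows from a lower bound for the variance in terms of a single u_n, and
    from a counting argument.

    Lower bound (centered_level_bound). If s u_n >= c on a set W for a sign s,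
    then Var f >= c^2 / n! * lambda^n(W). This is the contribution of one chaos
    in the Fock space representation of the variance, but only duality with
    multiple integrals is used. For a kernel h on X^n, the n-fold integral
    I_n(h) against the compensated process satisfies
      E f I_n(h) = int h u_n dlambda^n   and   E I_n(h)^2 <= n! int h^2 dlambda^n.
    Expanding 0 <= E (f - a I_n(1_W))^2 gives
      2 a int_W u_n dlambda^n - a^2 n! lambda^n(W) <= E f^2,
    and a = s c / n! turns the left-hand side into at least c^2 / n! lambda^n(W).
    Replacing f by f - E f changes no u_n with n >= 1.

    I_n(h) is needed only for h constant on products of the cells of a finite
    partition. There it is a polynomial in the counts of the cells, given by the
    recursion (chaos) that reads one coordinate at a time: if N_j is the count of
    the cell j and h_j fixes the first coordinate of h to j, then
      I_{n+1}(h)(N) = sum_j (N_j I_n(h_j)(N - e_j) - lambda_j I_n(h_j)(N)).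
    The Mecke equation E sum_{x in eta} g(eta, x) = int E g(eta + delta_x, x) dx
    shows that each summand is the adjoint of D integrated over the cell j
    (cell_adjoint), and the duality formula follows by induction
    (chaos_duality). Applied to f = I_n(h) itself, whose differences are again
    multiple integrals (chaos_difference), it bounds the second moment
    (chaos_second_moment). A general W of finite measure is approximated by
    unions of products of cells (box_variance_bound), and then X is exhausted by
    sets of finite measure (level_bound). The Mecke equation itself reduces to
    counts of finitely many cells, hence to the identity
    n P(Y = n) = r P(Y = n - 1) for a Poisson variable Y with mean r.

    Square-integrability of f says nothing direct about f(eta + delta_x). All
    integrability is obtained from the class tempered: functions integrable
    against every power of the number of points in a fixed set B of finite
    measure. It contains L^2, and it is preserved by multiplication with counts
    in B and, for almost every x in B, by adding the point x.

    Counting (difference_variance_bound). Inclusion-exclusion writes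
    f(mu + sum_{i in I} delta_{x_i}) as the sum of D^J f(mu) over J included in
    I, where D^J takes the differences in the points x_i with i in J
    (set_superposition_expansion). In the difference of the two expectations the
    term of the empty set cancels, so the sum of |u_J(x_J)| over the nonempty J
    is at least c for almost every x in U, and some nonempty J has
    |u_J(x_J)| >= c / 2^k (exists_large_mean_diff). There are at most 2^(k+1)
    pairs of a set J and a sign, so one of them occurs on a part V of U of
    measure at least lambda^k(U) / 2^(k+1) (measure_pigeonhole). The projection
    of V to the coordinates in J lies in the set where s u_J >= c / 2^k, and the
    lower bound applies with |J|! <= k!. *)

Set Implicit Arguments.
Unset Strict Implicit.
Unset Printing Implicit Defensive.

Import Order.TTheory GRing.Theory Num.Theory.
Import numFieldNormedType.Exports.

Local Open Scope classical_set_scope.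
Local Open Scope ring_scope.

(** * Measures with a density *)

Section weighted_measure.
Local Open Scope ereal_scope.
Context d (T : measurableType d) (R : realType).
Variables (m : {measure set T -> \bar R}) (w : T -> \bar R).
Hypotheses (mw : measurable_fun setT w) (w0 : forall x, (0 <= w x)).

(** The proofs are arguments, so that the measure structure, which depends on
    them, can be inferred from the term. *)
Definition weighted of measurable_fun setT w & (forall x, (0 <= w x)) :=
  fun A : set T => (\int[m]_(x in A) w x).

Local Notation nu := (weighted mw w0).

Let weighted0 : nu set0 = 0.
Proof. by rewrite /weighted integral_set0. Qed.

Let weighted_ge0 A : (0 <= nu A).
Proof. by apply: integral_ge0 => x _. Qed.

Let weighted_sigma_additive : semi_sigma_additive nu.
Proof. exact: semi_sigma_additive_nng_induced. Qed.

HB.instance Definition _ := isMeasure.Build _ _ _ nu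
  weighted0 weighted_ge0 weighted_sigma_additive.

Import HBNNSimple.

Let integral_weighted_nnsfun (f : {nnsfun T >-> R}) :
  (\int[nu]_x (f x)%:E = \int[m]_x ((f x)%:E * w x)).
Proof.
under [in LHS]eq_integral do rewrite fimfunE -fsumEFin//.
rewrite ge0_integral_fsum//; last 2 first.
  - by move=> r; exact/measurable_EFinP/measurableT_comp.
  - by move=> n x _; rewrite EFinM nnfun_muleindic_ge0.
under [RHS]eq_integral.
  move=> x _; rewrite fimfunE -fsumEFin// ge0_mule_fsuml; last first.
    by move=> r; rewrite EFinM nnfun_muleindic_ge0.
  over.
rewrite [RHS]ge0_integral_fsum//; last 2 first.
  - move=> r; apply: emeasurable_funM => //.
    by exact/measurable_EFinP/measurableT_comp.
  - by move=> n x _; rewrite mule_ge0// EFinM nnfun_muleindic_ge0.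
apply: eq_fsbigr => r _.
rewrite integralZl_indic_nnsfun//= integral_indic//= setIT /weighted.
have [r0|r0] := ltP r 0%R.
  rewrite preimage_nnfun0// integral_set0 mule0.
  by apply/esym/integral0_eq => x _; rewrite indicE in_set0 mulr0 mul0e.
under [RHS]eq_integral do rewrite EFinM -muleA.
rewrite ge0_integralZl//; last 2 first.
- by apply: emeasurable_funM => //; exact/measurable_EFinP.
- by move=> x _; rewrite mule_ge0// lee_fin.
congr (_ * _); rewrite integral_mkcond; apply: eq_integral => x _.
by rewrite epatch_indic muleC.
Qed.

(** True for simple functions by the definition of the measure; both sides are
    continuous along the increasing simple approximations of f. *)
Lemma ge0_integral_weighted (f : T -> \bar R) :
  measurable_fun setT f -> (forall x, (0 <= f x)) ->
  (\int[nu]_x f x = \int[m]_x (f x * w x)).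
Proof.
move=> mf f0; pose f_ := nnsfun_approx measurableT mf.
have f_f x : (f_ n x)%:E @[n --> \oo] --> f x by exact: cvg_nnsfun_approx.
transitivity (limn (fun n => \int[nu]_x (f_ n x)%:E)).
  rewrite -monotone_convergence//=.
  - by apply: eq_integral => x _; exact/esym/cvg_lim.
  - by move=> n; exact/measurable_EFinP.
  - by move=> n x _; rewrite lee_fin.
  - by move=> x _ a b ab; rewrite lee_fin//; exact/lefP/nd_nnsfun_approx.
transitivity (limn (fun n => \int[m]_x ((f_ n x)%:E * w x))).
  by congr (limn _); apply/funext => n /=; exact: integral_weighted_nnsfun.
have mfw n : measurable_fun setT (fun x => ((f_ n x)%:E * w x)).
  by apply: emeasurable_funM => //; exact/measurable_EFinP.
have fw0 n x : (0 <= (f_ n x)%:E * w x) by rewrite mule_ge0// lee_fin.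
have fwnd x : nondecreasing_seq (fun n => (f_ n x)%:E * w x).
  move=> a b ab; apply: lee_wpmul2r => //.
  by rewrite lee_fin//; exact/lefP/nd_nnsfun_approx.
rewrite -monotone_convergence//.
apply: eq_integral => x _; apply/cvg_lim => //.
have [fx0|fx0] := eqVneq (f x) 0.
  rewrite fx0 mul0e; apply: cvg_near_cst; apply: nearW => n.
  have := le_approx n (fun x _ => f0 x) (I : setT x).
  rewrite -nnsfun_approxE// fx0 lee_fin -/(f_ n x) => fn0.
  have -> : f_ n x = 0%R by apply/eqP; rewrite eq_le fn0 fun_ge0.
  by rewrite mul0e.
case wx : (w x) => [r| |]; last by have := w0 x; rewrite wx.
  exact: cvgeZr.
apply: cvgeM => //; last exact: cvg_cst.
by rewrite mule_defE (negbTE fx0) /=.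
Qed.

End weighted_measure.

(** * Image measures *)

Section image_measure.
Local Open Scope ereal_scope.
Context d1 d2 (X : measurableType d1) (Y : measurableType d2) (R : realType).
Variables (mu : {measure set X -> \bar R}) (phi : X -> Y).
Hypothesis mphi : measurable_fun setT phi.

(** As for weighted, the measurability proof is an argument for the sake of
    inference: phi ranges here over functions that carry no measurability
    structure. *)
Definition image_measure of measurable_fun setT phi :=
  fun A : set Y => mu (phi @^-1` A).

Local Notation nu := (image_measure mphi).

Let image_measure0 : nu set0 = 0.
Proof. by rewrite /image_measure preimage_set0 measure0. Qed.

Let image_measure_ge0 A : 0 <= nu A.
Proof. exact: measure_ge0. Qed.

Let measurable_preimage A : measurable A -> measurable (phi @^-1` A).
Proof. by move=> mA; rewrite -[X in measurable X]setTI; exact: mphi. Qed.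

Let image_measure_sigma_additive : semi_sigma_additive nu.
Proof.
move=> F mF tF mUF; rewrite /image_measure preimage_bigcup.
apply: measure_semi_sigma_additive.
- by move=> i; exact: measurable_preimage.
- apply/trivIsetP => /= i j _ _ ij; rewrite -preimage_setI.
  by move/trivIsetP : tF => /(_ _ _ _ _ ij) ->//; rewrite preimage_set0.
- by rewrite -preimage_bigcup; exact: measurable_preimage.
Qed.

HB.instance Definition _ := isMeasure.Build _ _ _ nu
  image_measure0 image_measure_ge0 image_measure_sigma_additive.

End image_measure.

Section image_measure_integral.
Local Open Scope ereal_scope.
Context d1 d2 (X : measurableType d1) (Y : measurableType d2) (R : realType).
Variables (phi : X -> Y) (mphi : measurable_fun setT phi).
Variables (mu : {measure set X -> \bar R}) (nu : {measure set Y -> \bar R}).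
Hypothesis nuE : forall A, measurable A -> nu A = mu (phi @^-1` A).

Lemma ge0_integral_image_measure (f : Y -> \bar R) :
  measurable_fun setT f -> (forall y, 0 <= f y) ->
  \int[nu]_y f y = \int[mu]_x f (phi x).
Proof.
move=> mf f0.
have := @ge0_integral_pushforward _ _ _ _ _ _ mphi mu setT f measurableT mf
  (fun y _ => f0 y).
rewrite preimage_setT => <-; apply: eq_measure_integral => A mA _.
exact: nuE.
Qed.

Lemma integral_image_measure (f : Y -> \bar R) : measurable_fun setT f ->
  \int[nu]_y f y = \int[mu]_x f (phi x).
Proof.
move=> mf; rewrite integralE [RHS]integralE.
have -> : (fun x => f (phi x))^\+ = f^\+ \o phi := funepos_comp f phi.
have -> : (fun x => f (phi x))^\- = f^\- \o phi := funeneg_comp f phi.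
rewrite (ge0_integral_image_measure (measurable_funepos mf))//.
by rewrite (ge0_integral_image_measure (measurable_funeneg mf)).
Qed.

End image_measure_integral.

(** * Integration over the powers of a measure *)

Section power_measure_fubini.
Local Open Scope ereal_scope.
Context d (X : measurableType d) (R : realType).
Variable lambda : {sigma_finite_measure set X -> \bar R}.
Local Notation lam := (power_measure lambda).

Let lamS n A : measurable A ->
  lam n.+1 A = (lambda \x lam n) (@tuple_cons d X n @^-1` A).
Proof. by []. Qed.

Lemma ge0_integral_powerS n (f : n.+1.-tuple X -> \bar R) :
  measurable_fun setT f -> (forall t, 0 <= f t) ->
  \int[lam n.+1]_t f t = \int[lambda]_x \int[lam n]_t f (tuple_cons (x, t)).
Proof.
move=> mf f0.
rewrite (ge0_integral_image_measure (@measurable_tuple_cons _ X n) (@lamS n))//.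
apply: (fubini_tonelli1 (f \o @tuple_cons d X n) _ (fun z => f0 _)).
by apply: measurableT_comp => //; exact: measurable_tuple_cons.
Qed.

Let integrable_tuple_cons n (f : n.+1.-tuple X -> \bar R) :
  (lam n.+1).-integrable setT f ->
  (lambda \x lam n).-integrable setT (f \o @tuple_cons d X n).
Proof.
move=> intf; have mf := measurable_int _ intf.
have mtc := @measurable_tuple_cons _ X n.
apply/integrableP; split; first exact: measurableT_comp.
case/integrableP : intf => _.
by rewrite (ge0_integral_image_measure mtc (@lamS n))//; exact: measurableT_comp.
Qed.

Lemma integral_powerS n (f : n.+1.-tuple X -> \bar R) :
  (lam n.+1).-integrable setT f ->
  \int[lam n.+1]_t f t = \int[lambda]_x \int[lam n]_t f (tuple_cons (x, t)).
Proof.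
move=> intf; have mf := measurable_int _ intf.
rewrite (integral_image_measure (@measurable_tuple_cons _ X n) (@lamS n))//.
by apply/esym; exact: (integral12_prod_meas1 (integrable_tuple_cons intf)).
Qed.

Lemma measurable_integral_powerS n (f : n.+1.-tuple X -> \bar R) :
  (lam n.+1).-integrable setT f ->
  measurable_fun setT (fun x => \int[lam n]_t f (tuple_cons (x, t))).
Proof.
by move=> intf; exact: (measurable_fubini_F (integrable_tuple_cons intf)).
Qed.

Lemma integral_power0 (f : 0.-tuple X -> \bar R) :
  \int[lam 0]_t f t = f [tuple].
Proof.
rewrite (eq_integral (cst (f [tuple]))) => [|t _]; last by rewrite (tuple0 t).
by rewrite integral_cst//= diracE in_setT mule1.
Qed.

End power_measure_fubini.

(** * Approximation of measurable sets by an algebra *)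

Section approximation_by_algebra.
Context d (T : measurableType d) (R : realType).
Variables (nu : {measure set T -> \bar R}) (G : set (set T)).
Hypotheses (nuT : (nu setT < +oo)%E) (mG : G `<=` measurable)
  (GT : G setT) (GC : setC_closed G) (GU : setU_closed G).

(** The approximation is in measure, by sets of the algebra G. *)
Definition approximable (A : set T) := measurable A /\
  forall e : R, 0 < e -> exists2 B, G B & (nu (A `+` B) < e%:E)%E.

Let sub_approximable : G `<=` approximable.
Proof.
move=> A GA; split=> [|e e0]; first exact: mG.
by exists A => //; rewrite setYK measure0 lte_fin.
Qed.

Let mY A B : measurable A -> G B -> measurable (A `+` B).
Proof.
by move=> mA /mG mB; rewrite setY_def; apply: measurableU; exact: measurableD.
Qed.

Let approximableU A B : approximable A -> approximable B ->
  approximable (A `|` B).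
Proof.
move=> [mA hA] [mB hB]; split=> [|e e0]; first exact: measurableU.
have e20 : 0 < e / 2 by rewrite divr_gt0.
have [A' GA' A'e] := hA _ e20; have [B' GB' B'e] := hB _ e20.
exists (A' `|` B'); first exact: GU.
apply: (@le_lt_trans _ _ (nu ((A `+` A') `|` (B `+` B')))).
  apply: le_measure; rewrite ?inE.
  - by apply: mY; [exact: measurableU|exact: GU].
  - by apply: measurableU; exact: mY.
  - by move=> x; rewrite !setY_def /=; tauto.
apply: (le_lt_trans (measureU2 _ _ _)); [exact: mY|exact: mY|].
by rewrite [e]splitr EFinD lteD.
Qed.

Let approximableC A : approximable A -> approximable (~` A).
Proof.
move=> [mA hA]; split=> [|e e0]; first exact: measurableC.
have [B GB Be] := hA _ e0; exists (~` B); first exact: GC.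
suff -> : ~` A `+` ~` B = A `+` B by [].
apply/seteqP; split => x; rewrite !setY_def /=.
  by move=> [[? /contrapT]|[? /contrapT]]; tauto.
by move=> [[? ?]|[? ?]]; [right|left]; split => //; apply.
Qed.

Let approximable0 : approximable set0.
Proof. by rewrite -setCT; apply/sub_approximable/GC. Qed.

Let approximable_bigcup (F : (set T)^nat) :
  (forall i, approximable (F i)) -> approximable (\bigcup_i F i).
Proof.
move=> hF; pose S n := \big[setU/set0]_(i < n) F i.
have hS n : approximable (S n).
  by rewrite /S; elim/big_ind : _ => //; exact: approximableU.
have mF i : measurable (F i) by have [] := hF i.
have mUF : measurable (\bigcup_i F i) by exact: bigcupT_measurable.
have mS n : measurable (S n) by have [] := hS n.
split=> // e e0; have e20 : 0 < e / 2 by rewrite divr_gt0.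
(* The tails decrease to the empty set, so some finite union is close. *)
have UF : \bigcap_n (\bigcup_i F i `\` S n) = set0.
  apply/seteqP; split => // x /= h.
  have [[i _ Fix] _] := h 0%N Logic.I.
  have [_] := h i.+1 Logic.I; apply; rewrite /S -bigcup_mkord.
  by exists i => //=.
have : nu (\bigcup_i F i `\` S n) @[n --> \oo] --> nu set0.
  rewrite -UF; apply: nonincreasing_cvg_mu.
  - apply: le_lt_trans nuT; apply: le_measure; rewrite ?inE//.
    exact: measurableD.
  - by move=> i; exact: measurableD.
  - by rewrite UF.
  - move=> a b ab; apply/subsetPset => x [UFx Sx]; split => // Sax; apply: Sx.
    move: Sax; rewrite /S -!bigcup_mkord => -[i /= ia Fix].
    by exists i => //=; exact: leq_trans ab.
rewrite measure0 => /fine_cvgP[_ /cvgrPdist_lt /(_ _ e20)] [N _].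
move=> /(_ N (leqnn N)) /=; rewrite sub0r normrN => hN.
have [B GB BeN] := (hS N).2 _ e20; exists B => //.
apply: (@le_lt_trans _ _ (nu ((\bigcup_i F i `\` S N) `|` (S N `+` B)))).
  apply: le_measure; rewrite ?inE.
  - exact: mY.
  - by apply: measurableU; [exact: measurableD|exact: mY].
  - move=> x; rewrite !setY_def /=.
    have SU : S N x -> (\bigcup_i F i) x.
      by rewrite /S -bigcup_mkord => -[i _ Fix]; exists i.
    have [] := pselect (S N x); tauto.
apply: (le_lt_trans (measureU2 _ _ _)); [exact: measurableD|exact: mY|].
rewrite [e]splitr EFinD lteD//.
have nuf : (nu (\bigcup_i F i `\` S N) \is a fin_num)%E.
  rewrite ge0_fin_numE//; apply: le_lt_trans nuT.
  by apply: le_measure; rewrite ?inE//; exact: measurableD.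
by have := le_lt_trans (ler_norm _) hN; rewrite -lte_fin fineK.
Qed.

(** The approximable sets form a sigma-algebra: since nu is finite, a countable
    union is approximated by its finite subunions, and those are approximated
    term by term. *)
Lemma g_sigma_algebra_approximable A : <<s G >> A -> approximable A.
Proof.
apply: smallest_sub => //; split => //.
- by move=> B hB; rewrite setTD; exact: approximableC.
Qed.

End approximation_by_algebra.

(** * Point measures and their counts *)

Section finite_additivity.
Local Open Scope ereal_scope.
Context d (T : measurableType d) (R : realType) (mu : {measure set T -> \bar R}).

Lemma measure_finite_partition (I : finType) (D : pred I) (F : I -> set T) :
  (forall i, measurable (F i)) -> trivIset setT F ->
  mu (\bigcup_(i in [set` D]) F i) = \sum_(i | D i) mu (F i).
Proof.
move=> mF tF; rewrite measure_fin_bigcup//; last exact: sub_trivIset tF.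
rewrite -(@bigfs _ _ _ _ (index_enum I))//; first exact: index_enum_uniq.
by move=> i _; rewrite mem_index_enum.
Qed.

End finite_additivity.

Section point_measure_measurability.
Context d (X : measurableType d) (R : realType).
Local Notation N := (point_measure X R).

Lemma measurable_pm_eval (B : set X) : measurable B ->
  measurable_fun [set: N] (fun mu : N => mu B).
Proof.
move=> mB _ Y mY; rewrite setTI; apply: sub_sigma_algebra.
by exists B => //; exists Y => //; rewrite setTI.
Qed.

Lemma measurable_fun_pmP d' (Y : measurableType d') (g : Y -> N) :
  (forall B, measurable B -> measurable_fun setT (fun y => g y B)) ->
  measurable_fun setT g.
Proof.
move=> mg; apply: (measurability (\bigcup_(B in measurable) preimg_pm_ev B)).
  by [].
move=> _ [_ [B mB [Y' mY' <-]] <-]; rewrite !setTI.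
have := mg _ mB measurableT _ mY'; by rewrite setTI.
Qed.

Definition add_point (z : X * N) : N := pm_dirac z.1 + z.2.

Lemma add_pointE z B : add_point z B = ((\1_B z.1)%:E + z.2 B)%E.
Proof. by rewrite /add_point point_measureD /= diracE indicE. Qed.

Lemma measurable_add_point : measurable_fun setT add_point.
Proof.
apply: measurable_fun_pmP => B mB.
under eq_fun do rewrite add_pointE.
apply: emeasurable_funD.
  apply/measurable_EFinP.
  exact: (measurableT_comp (@measurable_indic _ _ R setT _ mB)
                           (@measurable_fst _ _ X N)).
exact: (measurableT_comp (measurable_pm_eval mB) measurable_snd).
Qed.

HB.instance Definition _ :=
  isMeasurableFun.Build _ _ _ _ add_point measurable_add_point.

(** The values of a point measure, with None for +oo; unlike the extended reals,
    they form a countable type. *)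
Definition count_value (o : option nat) : \bar R :=
  if o is Some n then n%:R%:E else +oo%E.

Lemma count_valueP (mu : N) B : measurable B ->
  exists o, mu B = count_value o.
Proof.
move=> mB; case muB : (mu B) => [r| |].
- have [|n nE] := @point_measure_integer _ _ _ mu B mB; first by rewrite muB ltry.
  by exists (Some n); rewrite -muB nE.
- by exists None.
- by have : (0 <= mu B)%E := measure_ge0 mu B; rewrite muB.
Qed.

Lemma count_value_inj : injective count_value.
Proof.
case=> [m|] [n|] //= /eqP; rewrite eqe eqr_nat => /eqP mn; by rewrite mn.
Qed.

Lemma count_value_ge0 o : (0 <= count_value o)%E.
Proof. by case: o => [n|]; rewrite ?leey//= lee_fin ler0n. Qed.

End point_measure_measurability.

(** * The Poisson distribution *)

Section poisson_law.
Local Open Scope ereal_scope.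
Context (R : realType).

(** The identity n P(Y = n) = r P(Y + 1 = n), in a form that also covers the
    values 0 and +oo, where both sides vanish. It is the one-dimensional case of
    the Mecke equation. *)
Lemma poisson_law_size_bias (r : R) (o : option nat) : (0 <= r)%R ->
  count_value R o * poisson_law r%:E [set count_value R o] =
  r%:E * poisson_law r%:E [set y | 1 + y = count_value R o].
Proof.
move=> r0; case: o => [n|]; last first.
  rewrite /poisson_law /=.
  rewrite [X in _ = _ * poisson_prob _ _ X](_ : _ = set0); last first.
    by apply/seteqP; split => // n /=; rewrite -EFinD.
  rewrite (_ : [set n | _] = set0); last by apply/seteqP; split.
  by rewrite measure0 !mule0.
case: n => [|n].
  rewrite mul0e /poisson_law [X in _ = _ * poisson_prob _ _ X](_ : _ = set0).
    by rewrite measure0 mule0.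
  apply/seteqP; split => // n /= /eqP.
  by rewrite -EFinD nat1r eqe pnatr_eq0.
rewrite /poisson_law (_ : [set n0 | _] = [set n.+1]); last first.
  by apply/seteqP; split => m /=; [move=> /eqP; rewrite eqe eqr_nat => /eqP|move=> ->].
rewrite [X in _ = _ * poisson_prob _ _ X](_ : _ = [set n]); last first.
  apply/seteqP; split => m /=; last by move=> ->; rewrite -EFinD nat1r.
  by rewrite -EFinD nat1r => /eqP; rewrite eqe eqr_nat eqSS => /eqP.
rewrite /poisson_prob; case: ifPn => [rgt0|]; last first.
  rewrite -leNgt => r0'; have -> : r = 0%R by apply/eqP; rewrite eq_le r0 r0'.
  by rewrite mul0e diracE memNset ?mule0//=.
rewrite !esum_set1 ?lee_fin ?poisson_pmf_ge0// -!EFinM; congr EFin.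
rewrite /poisson_pmf rgt0 exprS factS natrM invfM.
by field; rewrite /= pnatr_eq0 -lt0n fact_gt0/= addrC natr1 pnatr_eq0.
Qed.

End poisson_law.

(** * Events depending on the counts of finitely many cells *)

Section countable_partition.
Local Open Scope ereal_scope.
Context d (T : measurableType d) (R : realType).

Lemma eq_measure_countable_partition (m1 m2 : {measure set T -> \bar R})
    (U : countType) (F : U -> set T) :
  (forall u, measurable (F u)) -> trivIset setT F ->
  (forall u, m1 (F u) = m2 (F u)) -> m1 (\bigcup_u F u) = m2 (\bigcup_u F u).
Proof.
move=> mF tF m12; pose F' n := oapp F set0 (pickle_inv n : option U).
have -> : \bigcup_u F u = \bigcup_n F' n.
  apply/seteqP; split=> x [].
    by move=> u _ Fux; exists (pickle u) => //; rewrite /F' pickleK_inv.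
  by move=> n _; rewrite /F'; case: pickle_inv => //= u Fux; exists u.
have mF' n : measurable (F' n) by rewrite /F'; case: pickle_inv => /=.
have tF' : trivIset setT F'.
  move=> i j _ _ [x []]; rewrite /F'.
  have := @pickle_invK U i; have := @pickle_invK U j.
  case: pickle_inv => //= u <-; case: pickle_inv => //= v <- Fu Fv.
  by congr pickle; apply: tF => //; exists x.
rewrite !measure_bigcup//; apply: eq_eseriesr => n _.
by rewrite /F'; case: pickle_inv => /=; rewrite ?measure0.
Qed.

End countable_partition.

Section cell_counts.
Local Open Scope ereal_scope.
Context d (X : measurableType d) (R : realType).
Local Notation N := (point_measure X R).

(** A finite partition of X is encoded by the map that sends a point to the
    label of its cell; refining partitions is then pairing of maps. *)
Definition measurable_cells (T : finType) (kappa : X -> T) :=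
  forall j, measurable (kappa @^-1` [set j]).

Lemma measurable_cellsE (T : finType) (kappa : X -> T) (D : set T) :
  measurable_cells kappa -> measurable (kappa @^-1` D).
Proof.
move=> mk; rewrite (_ : _ @^-1` _ = \bigcup_(j in D) kappa @^-1` [set j]).
  by apply: fin_bigcup_measurable => // j _; exact: mk.
apply/seteqP; split => x /=; first by move=> Dx; exists (kappa x).
by move=> [j Dj /= ->].
Qed.

Lemma measurable_cells_pair (T1 T2 : finType) (k1 : X -> T1) (k2 : X -> T2) :
  measurable_cells k1 -> measurable_cells k2 ->
  measurable_cells (fun x => (k1 x, k2 x)).
Proof.
move=> m1 m2 [j l].
rewrite (_ : _ @^-1` _ = k1 @^-1` [set j] `&` k2 @^-1` [set l]).
  exact: measurableI.
by apply/seteqP; split => x /=; [move=> [-> ->]|move=> [-> ->]].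
Qed.

Lemma measurable_cells_mem (B : set X) : measurable B ->
  measurable_cells (fun x => x \in B).
Proof.
move=> mB [].
  rewrite (_ : _ @^-1` _ = B)//.
  by apply/seteqP; split => x; [exact: set_mem|exact: mem_set].
rewrite (_ : _ @^-1` _ = ~` B); first exact: measurableC.
apply/seteqP; split => x /=; first by move=> /negbT; rewrite notin_setE.
by move=> xB; apply/negbTE; rewrite notin_setE.
Qed.

Definition cell_counts (T : finType) (kappa : X -> T) (mu : N) (j : T) :=
  mu (kappa @^-1` [set j]).

Lemma cell_countsE (T : finType) (kappa : X -> T) (mu : N) (D : pred T) :
  measurable_cells kappa ->
  mu (kappa @^-1` [set` D]) = \sum_(j | D j) cell_counts kappa mu j.
Proof.
move=> mk; rewrite -measure_finite_partition//; last exact: trivIset_preimage1.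
congr (mu _); apply/seteqP; split => x /=; first by move=> Dx; exists (kappa x).
by move=> [j Dj /= ->].
Qed.

Definition exact_counts (T : finType) (kappa : X -> T) (n : T -> option nat) :
    set N :=
  [set mu | forall j, cell_counts kappa mu j = count_value R (n j)].

Lemma measurable_counts_in (T : finType) (kappa : X -> T) (A : T -> set (\bar R)) :
  measurable_cells kappa -> (forall j, measurable (A j)) ->
  measurable [set mu : N | forall j, A j (cell_counts kappa mu j)].
Proof.
move=> mk mA.
rewrite (_ : [set mu | _] = \bigcap_(j in [set: T])
    ((fun mu : N => cell_counts kappa mu j) @^-1` A j)).
  apply: fin_bigcap_measurable => // j _.
  rewrite -[X in measurable X]setTI.
  exact: (measurable_pm_eval (mk j)).
by apply/seteqP; split => [mu h j _|mu h j]; exact: h.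
Qed.

(** Gam is an arbitrary set: as the counts take countably many values, the event is
    measurable all the same (measurable_counts_event). *)
Definition counts_event (T : finType) (kappa : X -> T)
    (Gam : set (T -> \bar R)) : set N :=
  [set mu | Gam (cell_counts kappa mu)].

Definition counts_events : set (set N) := [set G | exists (T : finType)
  (kappa : X -> T) (Gam : set (T -> \bar R)),
  measurable_cells kappa /\ G = counts_event kappa Gam].

Let exact_part (T : finType) (kappa : X -> T) (Gam : set (T -> \bar R))
    (n : {ffun T -> option nat}) : set N :=
  if `[< Gam (fun j => count_value R (n j)) >] then exact_counts kappa n else set0.

Let counts_eventE (T : finType) (kappa : X -> T) (Gam : set (T -> \bar R)) :
  measurable_cells kappa ->
  counts_event kappa Gam = \bigcup_n exact_part kappa Gam n.
Proof.
move=> mk; apply/seteqP; split=> mu /=.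
  move=> Gmu; have h j := count_valueP mu (mk j).
  pose n := [ffun j => xget None [set o | mu (kappa @^-1` [set j]) = count_value R o]].
  have nE j : cell_counts kappa mu j = count_value R (n j).
    rewrite ffunE; case: xgetP => [v _ hv|]; first exact: hv.
    by have [v hv] := h j; move=> /(_ v hv).
  exists n => //; rewrite /exact_part ifT//; apply/asboolP.
  by rewrite -(funext nE).
move=> [n _]; rewrite /exact_part; case: asboolP => // Gn /funext nE.
by rewrite /counts_event /= nE.
Qed.

Let measurable_exact_part (T : finType) (kappa : X -> T) Gam n :
  measurable_cells kappa -> measurable (@exact_part T kappa Gam n).
Proof.
move=> mk; rewrite /exact_part; case: ifP => // _.
by apply: (measurable_counts_in (A := fun j => [set count_value R (n j)])).
Qed.

Lemma measurable_counts_event (T : finType) (kappa : X -> T) Gam :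
  measurable_cells kappa -> measurable (@counts_event T kappa Gam).
Proof.
move=> mk; rewrite counts_eventE//.
apply: countable_bigcupT_measurable; first exact: countableP.
by move=> n; exact: measurable_exact_part.
Qed.

(** An event on the counts is a countable disjoint union of events that
    prescribe every count. *)
Lemma eq_measure_counts_event (m1 m2 : {measure set N -> \bar R}) (T : finType)
    (kappa : X -> T) Gam : measurable_cells kappa ->
  (forall n, m1 (exact_counts kappa n) = m2 (exact_counts kappa n)) ->
  m1 (counts_event kappa Gam) = m2 (counts_event kappa Gam).
Proof.
move=> mk m12; rewrite counts_eventE//.
apply: eq_measure_countable_partition.
- by move=> n; exact: measurable_exact_part.
- move=> n1 n2 _ _ [mu []]; rewrite /exact_part.
  case: ifP => // _ e1; case: ifP => // _ e2.
  by apply/ffunP => j; apply: (@count_value_inj R); rewrite -e1 -e2.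
- by move=> n; rewrite /exact_part; case: ifP => // _; rewrite !measure0.
Qed.

Lemma counts_event_comp (T T' : finType) (kappa : X -> T) (h : T -> T') Gam :
  measurable_cells kappa ->
  counts_event (h \o kappa) Gam = counts_event kappa
    [set c | Gam (fun j => \sum_(p | h p == j) c p)].
Proof.
move=> mk; apply/seteqP; split => mu; rewrite /counts_event /=;
suff -> : cell_counts (h \o kappa) mu = fun j =>
    \sum_(p | h p == j) cell_counts kappa mu p by [].
all: apply/funext => j; rewrite -(@cell_countsE _ _ mu (fun p => h p == j))//.
all: by congr (point_measure_val mu _); apply/seteqP; split => x /= /eqP.
Qed.

(** Two finite partitions have a common refinement. *)
Lemma setI_closed_counts_events : setI_closed counts_events.
Proof.
move=> G1 G2 [T1 [k1 [Gam1 [m1 ->]]]] [T2 [k2 [Gam2 [m2 ->]]]].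
pose k x := (k1 x, k2 x); have mk : measurable_cells k.
  exact: measurable_cells_pair.
rewrite -[k1]/(fst \o k) -[k2]/(snd \o k) !counts_event_comp//.
by eexists _, k, (_ `&` _); split.
Qed.

Lemma counts_events_setT : counts_events setT.
Proof.
exists unit, (fun=> tt), setT; split; last by [].
move=> []; rewrite (_ : _ @^-1` _ = setT); first exact: measurableT.
by apply/seteqP; split.
Qed.

Lemma measurable_counts_events : counts_events `<=` measurable.
Proof. by move=> G [T [k [Gam [mk ->]]]]; exact: measurable_counts_event. Qed.

(** The partition of X into B and its complement gives the events on mu B, which
    generate the sigma-algebra of point measures. *)
Lemma measurable_pm_counts_events : @measurable _ N `<=` <<s counts_events >>.
Proof.
apply: smallest_sub; first exact: smallest_sigma_algebra.
move=> _ [B mB [Y mY <-]]; apply: sub_sigma_algebra.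
exists bool, (fun x => x \in B), [set c | Y (c true)]; split.
  exact: measurable_cells_mem.
rewrite setTI; apply/seteqP; split => mu; rewrite /counts_event /cell_counts /=.
  rewrite (_ : _ @^-1` _ = B)//.
  by apply/seteqP; split => x; [exact: set_mem|exact: mem_set].
rewrite (_ : _ @^-1` _ = B)//.
by apply/seteqP; split => x; [exact: set_mem|exact: mem_set].
Qed.

End cell_counts.

(** * The Mecke equation *)

Section mecke.
Local Open Scope ereal_scope.
Context d (X : measurableType d) (R : realType).
Local Notation N := (point_measure X R).
Variables (lambda : {sigma_finite_measure set X -> \bar R}).
Variable Q : probability N R.

(** The Poisson process enters only through its law Q, and only through the joint
    law of the counts of finitely many disjoint sets. *)
Definition poisson_counts :=
  forall n (B : 'I_n -> set X) (A : 'I_n -> set (\bar R)),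
    (forall i, measurable (B i)) -> trivIset setT B ->
    (forall i, measurable (A i)) ->
    Q [set mu | forall i, A i (mu (B i))] =
      \prod_(i < n) poisson_law (lambda (B i)) (A i).

Hypothesis hQ : poisson_counts.

Lemma cell_counts_law (T : finType) (kappa : X -> T) (A : T -> set (\bar R)) :
  measurable_cells kappa -> (forall j, measurable (A j)) ->
  Q [set mu | forall j, A j (cell_counts kappa mu j)] =
  \prod_j poisson_law (lambda (kappa @^-1` [set j])) (A j).
Proof.
move=> mk mA.
rewrite (reindex (@enum_val T T))/=; last exact/onW_bij/enum_val_bij.
rewrite -(hQ (B := fun i => kappa @^-1` [set enum_val i])
             (A := fun i => A (enum_val i)))//; last first.
  by move=> i j _ _ [x [/= -> /enum_val_inj]].
congr (Q _); apply/seteqP; split => mu h; first by move=> i; exact: h.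
by move=> j; have := h (enum_rank j); rewrite enum_rankK.
Qed.

Let measurable_shift_fiber (b : bool) (v : \bar R) :
  measurable [set y : \bar R | b%:R%:E + y = v].
Proof.
rewrite (_ : [set y | _] = (fun y => b%:R%:E + y) @^-1` [set v])//.
rewrite -[X in measurable X]setTI; exact: emeasurable_funD.
Qed.

Let shifted_counts (T : finType) (kappa : X -> T) (n : T -> option nat) (j : T)
    : set N :=
  [set mu | forall i, (i == j)%:R%:E + cell_counts kappa mu i
                      = count_value R (n i)].

Let measurable_shifted_counts T kappa n j : measurable_cells kappa ->
  measurable (@shifted_counts T kappa n j).
Proof.
move=> mk; apply: (measurable_counts_in
  (A := fun i => [set y | (i == j)%:R%:E + y = count_value R (n i)])) => [//|i].
exact: measurable_shift_fiber.
Qed.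

(** The counts of distinct cells are independent, so the size-bias identity
    applies to the factor of the cell j alone. *)
Let shifted_counts_law (T : finType) (kappa : X -> T) (n : T -> option nat) (j : T) :
  measurable_cells kappa -> lambda (kappa @^-1` [set j]) < +oo ->
  count_value R (n j) * Q (exact_counts kappa n) =
  lambda (kappa @^-1` [set j]) * Q (shifted_counts kappa n j).
Proof.
move=> mk lj.
rewrite (cell_counts_law (A := fun i => [set count_value R (n i)]))//.
rewrite (cell_counts_law
  (A := fun i => [set y | (i == j)%:R%:E + y = count_value R (n i)]))//.
rewrite (bigD1 j)//= [in RHS](bigD1 j)//= !muleA eqxx.
have : lambda (kappa @^-1` [set j]) \is a fin_num by rewrite ge0_fin_numE.
move=> /fineK <-; rewrite poisson_law_size_bias ?fine_ge0//.
congr (_ * _); apply: eq_bigr => i /negbTE ->; congr (poisson_law _ _).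
by apply/seteqP; split => y /=; rewrite add0e.
Qed.

(** A point added at x in the cell j increases the count of that cell by one;
    summing shifted_counts_law over the cells contained in D gives the Mecke
    equation for this event. *)
Let mecke_exact_counts (T : finType) (kappa : X -> T) (D : pred T)
    (n : T -> option nat) : measurable_cells kappa ->
  (forall j, D j -> lambda (kappa @^-1` [set j]) < +oo) ->
  \int[Q]_(mu in exact_counts kappa n) mu (kappa @^-1` [set` D]) =
  (lambda \x Q) ((kappa @^-1` [set` D] `*` setT) `&`
                 @add_point _ X R @^-1` exact_counts kappa n).
Proof.
move=> mk lD.
have mE : measurable (exact_counts kappa n : set N).
  by apply: (measurable_counts_in (A := fun j => [set count_value R (n j)])).
under eq_integral => mu /set_mem muE.
  rewrite cell_countsE//; under eq_bigr do rewrite muE; over.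
rewrite integral_cst// ge0_sume_distrl; last by move=> *; exact: count_value_ge0.
rewrite (_ : _ `&` _ = \bigcup_(j in [set` D])
    (kappa @^-1` [set j] `*` shifted_counts kappa n j)); last first.
  apply/seteqP; split => -[x mu] /=.
    move=> [[Dx _] muE]; exists (kappa x) => //; split => // i.
    rewrite -muE /cell_counts add_pointE/= indicE; congr (_%:R%:E + _).
    by congr nat_of_bool; apply/eqP/idP => [->|/set_mem //]; exact/mem_set.
  move=> [j Dj /= [xj muE]]; split; first by rewrite xj.
  move=> i; rewrite -muE /cell_counts add_pointE/= indicE; congr (_%:R%:E + _).
  by congr nat_of_bool; rewrite -xj; apply/idP/eqP => [/set_mem //|->]; exact/mem_set.
rewrite measure_finite_partition//.
- apply: eq_bigr => j Dj; rewrite shifted_counts_law ?lD//.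
  by apply/esym; apply: product_measure1E => //; exact: measurable_shifted_counts.
- by move=> j; apply: measurableX => //; exact: measurable_shifted_counts.
- by move=> i j _ _ [[x mu] [/= [-> _] [-> _]]].
Qed.

Section fixed_set.
Variable B : set X.
Hypotheses (mB : measurable B) (lB : lambda B < +oo).

(** The two sides of the Mecke equation, as measures of the set whose indicator
    is g. They agree on the counts events, a pi-system generating the
    sigma-algebra, hence everywhere. *)
Let m1 : {measure set N -> \bar R} :=
  weighted Q (measurable_pm_eval mB) (fun mu => measure_ge0 mu B).

Let w (z : X * N) : \bar R := (\1_B z.1)%:E.

Let mw : measurable_fun setT w.
Proof.
apply/measurable_EFinP.
exact: (measurableT_comp (@measurable_indic _ _ R setT _ mB)
                           (@measurable_fst _ _ X N)).
Qed.

Let w0 z : 0 <= w z. Proof. by rewrite lee_fin. Qed.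

Let m2 : {measure set N -> \bar R} :=
  image_measure (weighted (lambda \x Q) mw w0) (@measurable_add_point _ X R).

Let m2E G : measurable G -> m2 G =
  (lambda \x Q) ((B `*` setT) `&` @add_point _ X R @^-1` G).
Proof.
move=> mG; rewrite /m2 /= /image_measure /weighted.
rewrite (eq_integral (fun z => (\1_(B `*` setT) z)%:E)); last first.
  move=> z _; rewrite /w !indicE; congr (_%:R%:E); congr nat_of_bool.
  by apply/idP/idP => /set_mem h; apply/mem_set; [split|case: h].
rewrite integral_indic//; last exact: measurableX.
by have := @measurable_add_point _ X R measurableT _ mG; rewrite setTI.
Qed.

Let m12_counts G : @counts_events _ X R G -> m1 G = m2 G.
Proof.
move=> [T [kappa [Gam [mk ->]]]].
(* Refined by B, so that B becomes a union of cells. *)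
pose k x := (kappa x, x \in B).
have mk' : measurable_cells k.
  by apply: measurable_cells_pair => //; exact: measurable_cells_mem.
rewrite -[kappa]/(fst \o k) counts_event_comp//.
apply: eq_measure_counts_event => // n.
have BE : B = k @^-1` [set` [pred p | p.2]].
  by apply/seteqP; split => x /=; [exact: mem_set|exact: set_mem].
have mE : measurable (exact_counts k n : set N).
  by apply: (measurable_counts_in (A := fun j => [set count_value R (n j)])).
have h := @mecke_exact_counts _ k [pred p | p.2] n mk'.
apply: (eq_trans _ (esym (m2E mE))); rewrite [in RHS]BE -h.
  by rewrite /m1 /weighted; apply: eq_integral => mu _; congr (mu _).
move=> j Dj; apply: le_lt_trans lB; apply: le_measure; rewrite ?inE//.
by move=> x /= kx; apply: set_mem; rewrite -kx in Dj.
Qed.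

Let m12 G : measurable G -> m1 G = m2 G.
Proof.
move=> /measurable_pm_counts_events mG.
have cT : \bigcup_(k : nat) (fun=> setT) k = setT :> set N by rewrite bigcup_const.
have h := @g_sigma_algebra_measure_unique _ _ _ (@counts_events _ X R)
  (@measurable_counts_events _ X R) (fun=> setT)
  (fun=> @counts_events_setT _ X R) cT m1 m2.
apply: h mG.
- exact: setI_closed_counts_events.
- exact: m12_counts.
- move=> _; rewrite (m12_counts (@counts_events_setT _ _ _))//.
  change (m2 setT < +oo); rewrite m2E// preimage_setT setIT.
  rewrite product_measure1E// [X in _ * X](_ : _ = 1) ?mule1//.
  exact: probability_setT.
Qed.

(** The Mecke equation for the functions g of the configuration, integrated over
    the points in a fixed set B. *)
Lemma mecke (g : N -> \bar R) : measurable_fun setT g -> (forall mu, 0 <= g mu) ->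
  \int[Q]_mu (g mu * mu B) =
  \int[lambda]_(x in B) \int[Q]_mu g (add_point (x, mu)).
Proof.
move=> mg g0.
rewrite -(ge0_integral_weighted Q (measurable_pm_eval mB)
            (fun mu => measure_ge0 mu B))// -/m1.
rewrite (eq_measure_integral m2); last by move=> G mG _; exact: m12.
rewrite (ge0_integral_image_measure (mu := weighted (lambda \x Q) mw w0)
  (@measurable_add_point _ X R))//.
have mga : measurable_fun setT (g \o @add_point _ X R).
  by apply: measurableT_comp => //; exact: measurable_add_point.
rewrite ge0_integral_weighted//.
pose f z := g (@add_point _ X R z) * w z.
have mf : measurable_fun setT f by apply: emeasurable_funM.
have f0 z : 0 <= f z by rewrite mule_ge0.
transitivity (\int[lambda]_x fubini_F Q f x).
  exact: fubini_tonelli1 mf f0.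
rewrite [RHS]integral_mkcond; apply: eq_integral => x _.
rewrite /fubini_F epatch_indic -ge0_integralZr//; last by rewrite lee_fin.
exact: (measurableT_comp mga (@measurable_pair1 _ _ X N x)).
Qed.

End fixed_set.

End mecke.

(** * Iterated difference operators *)

Section difference_operators.
Context d (X : measurableType d) (R : realType).
Local Notation N := (point_measure X R).
Implicit Types (f g : N -> R) (mu : N) (s t : seq X).

(** The iterated difference operator in the points of s. *)
Fixpoint diff f s mu : R :=
  if s is x :: s' then diff f s' (add_point (x, mu)) - diff f s' mu else f mu.

(** The same recursion with plus signs: the sum of g over all ways of adding some
    of the points of s. For g = |f| it dominates the differences of f at once for
    all sublists of s. *)
Fixpoint envelope g s mu : R :=
  if s is x :: s' then envelope g s' (add_point (x, mu)) + envelope g s' mu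
  else g mu.

Lemma add_pointCA x y mu :
  add_point (x, add_point (y, mu)) = add_point (y, add_point (x, mu)).
Proof. exact: addrCA. Qed.

(** Differences commute, so the outermost operator can be moved next to f. *)
Lemma diff_cons f x s :
  diff f (x :: s) = diff (fun mu => f (add_point (x, mu)) - f mu) s.
Proof.
elim: s => //= y s IH; apply/funext => mu.
rewrite -IH /= (add_pointCA x y); ring.
Qed.

Lemma envelope_cons g x s :
  envelope g (x :: s) = envelope (fun mu => g (add_point (x, mu)) + g mu) s.
Proof.
elim: s => //= y s IH; apply/funext => mu.
rewrite -IH /= (add_pointCA x y); ring.
Qed.

Lemma diff_subr_cst f (a : R) s : (0 < size s)%N ->
  diff (fun mu => f mu - a) s = diff f s.
Proof.
case: s => // x s _; rewrite !diff_cons; congr diff.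
by apply/funext => mu; ring.
Qed.

Lemma envelope_ge0 g s mu : (forall mu', 0 <= g mu') -> 0 <= envelope g s mu.
Proof. by move=> g0; elim: s mu => //= x s IH mu; rewrite addr_ge0. Qed.

Lemma normr_diff_le f s mu : `|diff f s mu| <= envelope (fun mu => `|f mu|) s mu.
Proof.
elim: s mu => //= x s IH mu.
by apply: (le_trans (ler_normB _ _)); exact: lerD.
Qed.

Lemma le_envelope_subseq g s t mu : (forall mu', 0 <= g mu') -> subseq t s ->
  envelope g t mu <= envelope g s mu.
Proof.
move=> g0; elim: s t mu => [|x s IH] [|y t] mu //=.
  by move=> _; apply: (le_trans (IH [::] mu (sub0seq s))); rewrite lerDr envelope_ge0.
case: eqP => [-> ts|_ ts]; first by rewrite lerD// IH.
by apply: (le_trans (IH (y :: t) mu ts)); rewrite lerDr envelope_ge0.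
Qed.

Lemma measurable_diff f n d' (Y : measurableType d') (m : Y -> N)
    (t : Y -> n.-tuple X) : measurable_fun setT f -> measurable_fun setT m ->
  measurable_fun setT t -> measurable_fun setT (fun y => diff f (t y) (m y)).
Proof.
move=> mf; elim: n m t => [|n IH] m t mm mt.
  under eq_fun do rewrite tuple0.
  exact: measurableT_comp.
under eq_fun do rewrite (tuple_eta (t _)) /=.
have mb : measurable_fun setT (fun y => [tuple of behead (t y)]).
  exact: (measurableT_comp (@measurable_behead _ X n) mt).
apply: measurable_funB; last exact: (IH m (fun y => [tuple of behead (t y)])).
apply: (IH (fun y => add_point (thead (t y), m y))
           (fun y => [tuple of behead (t y)])) => //.
apply: (measurableT_comp (@measurable_add_point _ X R)).
apply: measurable_fun_pair => //.
exact: (measurableT_comp (@measurable_tnth _ X n.+1 ord0) mt).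
Qed.

Lemma measurable_envelope g n d' (Y : measurableType d') (m : Y -> N)
    (t : Y -> n.-tuple X) : measurable_fun setT g -> measurable_fun setT m ->
  measurable_fun setT t -> measurable_fun setT (fun y => envelope g (t y) (m y)).
Proof.
move=> mg; elim: n m t => [|n IH] m t mm mt.
  under eq_fun do rewrite tuple0.
  exact: measurableT_comp.
under eq_fun do rewrite (tuple_eta (t _)) /=.
have mb : measurable_fun setT (fun y => [tuple of behead (t y)]).
  exact: (measurableT_comp (@measurable_behead _ X n) mt).
apply: measurable_funD; last exact: (IH m (fun y => [tuple of behead (t y)])).
apply: (IH (fun y => add_point (thead (t y), m y))
           (fun y => [tuple of behead (t y)])) => //.
apply: (measurableT_comp (@measurable_add_point _ X R)).
apply: measurable_fun_pair => //.
exact: (measurableT_comp (@measurable_tnth _ X n.+1 ord0) mt).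
Qed.

End difference_operators.

Section sublists.
Context (T : eqType).

Fixpoint sublists (s : seq T) : seq (seq T) :=
  if s is x :: s' then map (cons x) (sublists s') ++ sublists s' else [:: [::]].

Lemma mem_sublists s t : (t \in sublists s) = subseq t s.
Proof.
elim: s t => [|x s IH] [|y t] //=.
  by rewrite mem_cat IH sub0seq orbT.
rewrite mem_cat IH; case: eqP => [->|yx].
  rewrite mem_map ?IH; last by move=> ? ? [].
  apply/orP/idP => [[//|]|]; last by left.
  by apply: subseq_trans; exact: subseq_cons.
rewrite orb_idl// => /mapP[u _ [/yx]]; by [].
Qed.

Lemma sublists_uniq s : uniq s -> uniq (sublists s).
Proof.
elim: s => //= x s IH /andP[xs us]; rewrite cat_uniq IH// andbT.
rewrite map_inj_uniq ?IH//; last by move=> ? ? [].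
apply/hasPn => t; rewrite mem_sublists => ts; apply/mapP => -[u _ tE].
by move: xs; rewrite (mem_subseq ts)// tE mem_head.
Qed.

End sublists.

Section superposition_expansion.
Context d (X : measurableType d) (R : realType).
Local Notation N := (point_measure X R).

(** The shift by delta_x is 1 + D_x, so the shift by all points of s is the product
    of these operators, expanded over the sublists of s. *)
Lemma superposition_expansion (f : N -> R) (I : eqType) (x : I -> X)
    (s : seq I) (mu : N) :
  f (mu + \sum_(i <- s) pm_dirac (x i)) =
  \sum_(t <- sublists s) diff f (map x t) mu.
Proof.
elim: s mu => [|i s IH] mu; first by rewrite big_nil addr0 big_seq1.
rewrite big_cons addrCA addrA IH /= big_cat big_map /= -big_split.
by apply: eq_bigr => t _ /=; rewrite /add_point /= subrK.
Qed.

Lemma set_superposition_expansion (f : N -> R) (I : finType) (x : I -> X)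
    (A : {set I}) (mu : N) :
  f (mu + \sum_(i in A) pm_dirac (x i)) =
  \sum_(J : {set I} | J \subset A) diff f (map x (enum J)) mu.
Proof.
rewrite -big_enum superposition_expansion -[RHS]big_filter.
rewrite -[RHS](big_map (fun J : {set I} => enum J) xpredT
                       (fun t => diff f (map x t) mu)).
apply: perm_big; apply: uniq_perm.
- by apply: sublists_uniq; exact: enum_uniq.
- rewrite map_inj_uniq ?filter_uniq ?index_enum_uniq// => J K JK.
  by apply/setP => i; rewrite -(mem_enum J) JK mem_enum.
move=> t; rewrite mem_sublists; apply/idP/mapP.
  move=> tA; exists [set i in t]%SET.
    rewrite mem_filter mem_index_enum andbT; apply/fintype.subsetP => i.
    by rewrite inE => /(mem_subseq tA); rewrite mem_enum.
  have tI : subseq t (Finite.enum I).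
    by apply: subseq_trans tA _; exact: filter_subseq.
  have uI : uniq (Finite.enum I) by rewrite -enumT enum_uniq.
  have /(subseq_uniqP uI) {1}-> := tI.
  by rewrite /enum_mem; apply: eq_filter => i /=; rewrite inE.
move=> [J]; rewrite mem_filter => /andP[JA _] ->.
apply/(subseq_uniqP (enum_uniq _)); rewrite /enum_mem -filter_predI.
apply: eq_filter => i /=; rewrite mem_filter /= -enumT mem_enum andbT.
by rewrite andb_idr// => /(fintype.subsetP JA).
Qed.

End superposition_expansion.

(** * Integrability against powers of a count *)

Section boxes.
Local Open Scope ereal_scope.
Context d (X : measurableType d) (R : realType).
Variable lambda : {sigma_finite_measure set X -> \bar R}.
Variable B : set X.
Hypothesis mB : measurable B.

Definition box n : set (n.-tuple X) := [set t | forall i, B (tnth t i)].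
Arguments box : clear implicits.

Lemma measurable_box n : measurable (box n).
Proof.
rewrite (_ : box n = \bigcap_(i in [set: 'I_n]) ((@tnth n X ^~ i) @^-1` B)).
  apply: fin_bigcap_measurable => // i _.
  by rewrite -[X in measurable X]setTI; exact: measurable_tnth.
by apply/seteqP; split => [t ht i _|t ht i]; exact: ht.
Qed.

Lemma box_cons n x (t : n.-tuple X) :
  box n.+1 (tuple_cons (x, t)) <-> B x /\ box n t.
Proof.
split=> [h|[Bx Bt] i].
  split; first exact: (h ord0).
  by move=> i; have := h (lift ord0 i); rewrite tnthS.
by case: (unliftP ord0 i) => [j ->|->//]; rewrite tnthS; exact: Bt.
Qed.

Lemma power_measure_box n :
  power_measure lambda n (box n) = \prod_(i < n) lambda B.
Proof. exact: (@power_measure_rect _ _ _ lambda n (fun=> B)). Qed.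

Lemma ge0_integral_boxS n (f : n.+1.-tuple X -> \bar R) :
  measurable_fun setT f -> (forall t, 0 <= f t) ->
  \int[power_measure lambda n.+1]_(t in box n.+1) f t =
  \int[lambda]_(x in B) \int[power_measure lambda n]_(t in box n)
     f (tuple_cons (x, t)).
Proof.
move=> mf f0; rewrite integral_mkcond ge0_integral_powerS//; last 2 first.
- apply/(measurable_restrictT _ _).1; [exact: measurable_box|exact: measurable_funTS].
- by move=> t; exact: erestrict_ge0.
rewrite [RHS]integral_mkcond; apply: eq_integral => x _.
rewrite /patch; case: ifPn => [/set_mem Bx|/negP Bx]; last first.
  apply: integral0_eq => t _; rewrite memNset// => /box_cons[Bx' _].
  exact/Bx/mem_set.
rewrite [RHS]integral_mkcond; apply: eq_integral => t _; rewrite /patch.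
congr (if _ then _ else _); apply/idP/idP => /set_mem.
  by move=> /box_cons[_ ?]; exact/mem_set.
by move=> bt; apply/mem_set/box_cons.
Qed.

Lemma measurable_integral_boxS n (f : n.+1.-tuple X -> \bar R) :
  measurable_fun setT f -> (forall t, 0 <= f t) ->
  measurable_fun setT (fun x => \int[power_measure lambda n]_(t in box n)
     f (tuple_cons (x, t))).
Proof.
move=> mf f0; under eq_fun do rewrite integral_mkcond.
pose g (z : X * n.-tuple X) := ((f \o @tuple_cons d X n) \_ (setT `*` box n)) z.
have mg : measurable_fun setT g.
  apply/(measurable_restrictT _ _).1; first by apply: measurableX => //; exact: measurable_box.
  apply: measurable_funTS; apply: measurableT_comp => //.
  exact: measurable_tuple_cons.
have g0 z : 0 <= g z by apply: erestrict_ge0 => z' _; exact: f0.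
have := @measurable_fun_fubini_tonelli_F _ _ X _ R (power_measure lambda n) g mg g0.
congr measurable_fun; apply/funext => x; apply: eq_integral => t _.
rewrite /g /patch; congr (if _ then _ else _).
by apply/idP/idP => /set_mem h; apply/mem_set; [case: h|split].
Qed.

End boxes.
Arguments box {d X} B n.

(** A tuple has finitely many coordinates, and B increases. *)
Lemma bigcup_box d (X : measurableType d) (B : (set X)^nat) n :
  {homo B : i j / (i <= j)%N >-> (i <= j)%O} -> \bigcup_i B i = setT ->
  \bigcup_i box (B i) n = setT.
Proof.
move=> ndB TB; apply/seteqP; split => // t _.
have [|g gP] := @choice _ _ (fun x i => B i x).
  by move=> x; have : setT x by []; rewrite -TB => -[i _ Bx]; exists i.
exists (\max_(i < n) g (tnth t i))%N => // i.
move: (tnth t i) (gP (tnth t i)) (leq_bigmax (F := fun i => g (tnth t i)) i).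
by move=> x gx /ndB/subsetPset; apply.
Qed.

Section finite_counts.
Local Open Scope ereal_scope.
Context d (X : measurableType d) (R : realType).
Local Notation N := (point_measure X R).
Variables (lambda : {sigma_finite_measure set X -> \bar R}) (Q : probability N R).
Hypothesis hQ : poisson_counts lambda Q.
Variable B : set X.
Hypotheses (mB : measurable B) (lB : lambda B < +oo).
Implicit Types (f g : N -> R) (mu : N).

Lemma integral_count : \int[Q]_mu (mu B) = lambda B.
Proof.
transitivity (\int[Q]_mu (cst 1 mu * mu B)).
  by apply: eq_integral => mu _; rewrite mul1e.
rewrite (mecke hQ mB lB)//.
under eq_integral do rewrite integral_cst// mul1e.
rewrite (eq_integral (cst 1)); last by move=> x _; exact: probability_setT.
by rewrite integral_cst// mul1e.
Qed.

Lemma ae_finite_count : {ae Q, forall mu, mu B < +oo}.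
Proof.
have intB : Q.-integrable setT (fun mu : N => mu B).
  apply/integrableP; split; first exact: measurable_pm_eval.
  under eq_integral do rewrite gee0_abs//.
  by rewrite integral_count.
have := integrable_ae measurableT intB; apply: filterS => mu /(_ Logic.I).
by rewrite ge0_fin_numE.
Qed.

(** The number of points in B is almost surely finite, since its mean is
    lambda B. This matters because adding a point changes fine (mu B) by one only
    where mu B is finite. *)
Lemma eq_integral_finite_count (f g : N -> \bar R) :
  measurable_fun setT f -> measurable_fun setT g ->
  (forall mu, mu B < +oo -> f mu = g mu) -> \int[Q]_mu f mu = \int[Q]_mu g mu.
Proof.
move=> mf mg fg; apply: ae_eq_integral => //.
by apply: filterS ae_finite_count => mu muB _; exact: fg.
Qed.

Lemma ge0_le_integral_finite_count (f g : N -> \bar R) :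
  measurable_fun setT f -> measurable_fun setT g ->
  (forall mu, 0 <= f mu) -> (forall mu, 0 <= g mu) ->
  (forall mu, mu B < +oo -> f mu <= g mu) ->
  \int[Q]_mu f mu <= \int[Q]_mu g mu.
Proof.
move=> mf mg f0 g0 fg; apply: ae_ge0_le_integral => //.
by apply: filterS ae_finite_count => mu muB _; exact: fg.
Qed.

Definition num_points mu := fine (mu B).

Lemma measurable_num_points : measurable_fun setT num_points.
Proof.
by apply: (measurableT_comp (fine_measurable _)) => //; exact: measurable_pm_eval.
Qed.

Lemma num_points_ge0 mu : (0 <= num_points mu)%R. Proof. exact: fine_ge0. Qed.

Lemma num_points_add_point x mu : mu B < +oo ->
  num_points (add_point (x, mu)) = (\1_B x + num_points mu)%R.
Proof.
by move=> muB; rewrite /num_points add_pointE/= fineD// ge0_fin_numE.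
Qed.

Lemma ge0_mecke_num_points g : measurable_fun setT g -> (forall mu, (0 <= g mu)%R) ->
  \int[Q]_mu (g mu * num_points mu)%:E =
  \int[lambda]_(x in B) \int[Q]_mu (g (add_point (x, mu)))%:E.
Proof.
move=> mg g0; have mg' : measurable_fun setT (EFin \o g) by exact/measurable_EFinP.
have g0' mu : 0 <= (EFin \o g) mu by rewrite lee_fin.
rewrite -(mecke hQ mB lB mg' g0').
apply: eq_integral_finite_count.
- by apply/measurable_EFinP/measurable_funM => //; exact: measurable_num_points.
- by apply: emeasurable_funM; [exact/measurable_EFinP|exact: measurable_pm_eval].
- by move=> mu muB; rewrite EFinM /num_points fineK// ge0_fin_numE.
Qed.

Lemma measurable_shift g x : measurable_fun setT g ->
  measurable_fun setT (fun mu => g (add_point (x, mu))).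
Proof.
move=> mg; apply: (measurableT_comp mg).
exact: (measurableT_comp (@measurable_add_point _ X R) (@measurable_pair1 _ _ X N x)).
Qed.

Lemma measurable_weight g r : measurable_fun setT g ->
  measurable_fun setT (fun mu => (`|g mu| * (1 + num_points mu) ^+ r)%R).
Proof.
move=> mg; apply: measurable_funM; first exact: measurableT_comp.
by apply: measurable_funX; apply: measurable_funD => //; exact: measurable_num_points.
Qed.

Lemma count_weight_ge0 r mu : (0 <= (1 + num_points mu) ^+ r)%R.
Proof. by rewrite exprn_ge0// addr_ge0// num_points_ge0. Qed.

Lemma weight_ge0 g r mu : (0 <= `|g mu| * (1 + num_points mu) ^+ r)%R.
Proof. by rewrite mulr_ge0// count_weight_ge0. Qed.

(** The class is stable under multiplication by counts in B, and under adding a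
    point at almost every x in B (ae_tempered_shift); it contains the
    square-integrable functions (tempered_L2). *)
Definition tempered f := measurable_fun setT f /\
  forall r : nat, \int[Q]_mu (`|f mu| * (1 + num_points mu) ^+ r)%:E < +oo.

Lemma tempered_integrable f : tempered f -> Q.-integrable setT (EFin \o f).
Proof.
move=> [mf /(_ 0%N)]; under eq_integral do rewrite expr0 mulr1.
by move=> foo; apply/integrableP; split => //; exact/measurable_EFinP.
Qed.

Lemma le_tempered f g : measurable_fun setT f -> tempered g ->
  (exists C r, (0 <= C)%R /\
     forall mu, mu B < +oo -> (`|f mu| <= C * (`|g mu| * (1 + num_points mu) ^+ r))%R) ->
  tempered f.
Proof.
move=> mf [mg gT] [C [r [C0 fg]]]; split => // s.
apply: (@le_lt_trans _ _
  (\int[Q]_mu (C%:E * (`|g mu| * (1 + num_points mu) ^+ (r + s))%:E))).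
  apply: ge0_le_integral_finite_count.
  - by apply/measurable_EFinP; apply: measurable_weight.
  - by apply: measurable_funeM; apply/measurable_EFinP; apply: measurable_weight.
  - by move=> mu; rewrite lee_fin weight_ge0.
  - by move=> mu; rewrite mule_ge0 ?lee_fin ?exprn_ge0 ?weight_ge0.
  - move=> mu muB; rewrite -EFinM lee_fin exprD !mulrA ler_wpM2r//.
      by rewrite exprn_ge0// addr_ge0// num_points_ge0.
    by rewrite -mulrA fg.
rewrite ge0_integralZl//; last 2 first.
- by apply/measurable_EFinP; apply: measurable_weight.
- by move=> mu _; rewrite lee_fin weight_ge0.
by apply: lte_mul_pinfty => //; rewrite lee_fin.
Qed.

Lemma temperedD f g : tempered f -> tempered g -> tempered (fun mu => f mu + g mu)%R.
Proof.
move=> [mf fT] [mg gT]; split=> [|r]; first exact: measurable_funD.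
apply: (@le_lt_trans _ _ (\int[Q]_mu ((`|f mu| * (1 + num_points mu) ^+ r)%:E +
                                     (`|g mu| * (1 + num_points mu) ^+ r)%:E))).
  apply: ge0_le_integral => //.
  - by move=> mu _; rewrite lee_fin mulr_ge0// count_weight_ge0.
  - apply/measurable_EFinP; apply: measurable_weight; exact: measurable_funD.
  - by apply: emeasurable_funD; apply/measurable_EFinP; apply: measurable_weight.
  - move=> mu _; rewrite -EFinD lee_fin -mulrDl ler_wpM2r ?ler_normD//.
    by rewrite exprn_ge0// addr_ge0// num_points_ge0.
rewrite ge0_integralD//.
- exact: lte_add_pinfty.
- by move=> mu _; rewrite lee_fin mulr_ge0// count_weight_ge0.
- by apply/measurable_EFinP; apply: measurable_weight.
- by move=> mu _; rewrite lee_fin mulr_ge0// count_weight_ge0.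
- by apply/measurable_EFinP; apply: measurable_weight.
Qed.

Lemma temperedZ f (a : R) : tempered f -> tempered (fun mu => a * f mu)%R.
Proof.
move=> fT; have mf := fT.1; apply: (le_tempered _ fT).
  exact: measurable_funM.
by exists `|a|%R, 0%N; split => // mu _; rewrite expr0 mulr1 normrM.
Qed.

Lemma temperedB f g : tempered f -> tempered g -> tempered (fun mu => f mu - g mu)%R.
Proof.
move=> fT /(temperedZ (-1)) gT.
rewrite (_ : (fun mu => _) = (fun mu => f mu + -1 * g mu)%R).
  exact: temperedD.
by apply/funext => mu; rewrite mulN1r.
Qed.

(** All moments of the number b of points are finite, by induction on the order:
    E (1+b)^(r+1) = E (1+b)^r + E (1+b)^r b, and by the Mecke equation the last
    term is lambda(B) E (2+b)^r <= lambda(B) 2^r E (1+b)^r. *)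
Lemma tempered_cst (a : R) : tempered (cst a).
Proof.
suff h : tempered (cst 1%R).
  by have := temperedZ a h; congr tempered; apply/funext => mu; rewrite /= mulr1.
split => //; elim=> [|r IH].
  under eq_integral do rewrite normr1 mul1r expr0.
  by rewrite integral_cst// mul1e -ge0_fin_numE//; exact: fin_num_measure.
pose W mu := (`|cst 1 mu| * (1 + num_points mu) ^+ r)%R.
have mW : measurable_fun setT W by exact: measurable_weight.
have W0 mu : (0 <= W mu)%R by exact: weight_ge0.
have mWE : measurable_fun setT (EFin \o W) by exact/measurable_EFinP.
have Woo : 0 <= \int[Q]_mu (W mu)%:E.
  by apply: integral_ge0 => mu _; rewrite lee_fin.
have mWc : measurable_fun setT (fun mu => (W mu * num_points mu)%:E).
  by apply/measurable_EFinP/measurable_funM => //; exact: measurable_num_points.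
rewrite (eq_integral (fun mu => (W mu)%:E + (W mu * num_points mu)%:E)); last first.
  by move=> mu _; rewrite /W exprSr mulrA mulrDr mulr1.
rewrite ge0_integralD//; last 2 first.
- by move=> mu _; rewrite lee_fin.
- by move=> mu _; rewrite lee_fin mulr_ge0// num_points_ge0.
apply: lte_add_pinfty => //.
rewrite ge0_mecke_num_points//.
have h x : B x -> \int[Q]_mu (W (add_point (x, mu)))%:E <=
    (2 ^+ r)%:E * \int[Q]_mu (W mu)%:E.
  move=> Bx; have c0 : 0 <= (2 ^+ r)%:E :> \bar R by rewrite lee_fin exprn_ge0.
  have WE0 mu : setT mu -> 0 <= (EFin \o W) mu by rewrite lee_fin.
  rewrite -(ge0_integralZl Q measurableT mWE WE0 c0).
  apply: ge0_le_integral_finite_count.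
  - by apply/measurable_EFinP; exact: measurable_shift.
  - exact: measurable_funeM.
  - by move=> mu; rewrite lee_fin.
  - by move=> mu; rewrite mule_ge0// lee_fin// exprn_ge0.
  - move=> mu muB; rewrite -EFinM lee_fin /W /= normr1 !mul1r -exprMn lerXn2r ?nnegrE//.
    + by rewrite addr_ge0// num_points_ge0.
    + by rewrite mulr_ge0// addr_ge0// num_points_ge0.
    + rewrite num_points_add_point// indicE mem_set//=; have := num_points_ge0 mu; lra.
apply: (@le_lt_trans _ _ (\int[lambda]_(x in B)
   cst ((2 ^+ r)%:E * \int[Q]_mu (W mu)%:E) x)).
  apply: ge0_le_integral => //.
  - by move=> x _; apply: integral_ge0 => mu _; rewrite lee_fin.
  - apply: measurable_funTS.
    apply: (@measurable_fun_fubini_tonelli_F _ _ X N R Q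
      (fun z => (W (add_point z))%:E)).
      apply/measurable_EFinP.
      exact: (measurableT_comp mW (@measurable_add_point _ X R)).
    by move=> z; rewrite lee_fin.
rewrite integral_cst//; apply: lte_mul_pinfty => //.
- by rewrite mule_ge0// lee_fin exprn_ge0.
- by rewrite fin_numM// ge0_fin_numE.
Qed.

End finite_counts.

(** * The Mecke equation for tempered functions *)

Section signed_mecke.
Local Open Scope ereal_scope.
Context d (X : measurableType d) (R : realType).
Local Notation N := (point_measure X R).
Variables (lambda : {sigma_finite_measure set X -> \bar R}) (Q : probability N R).
Hypothesis hQ : poisson_counts lambda Q.
Variable B : set X.
Hypotheses (mB : measurable B) (lB : lambda B < +oo).
Implicit Types (f g : N -> R) (mu : N).
Local Notation tempered := (tempered Q B).

(** |f| w <= f^2 + w^2, and all powers of the count are integrable. *)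
Lemma tempered_L2 f : measurable_fun setT f ->
  \int[Q]_mu (f mu ^+ 2)%:E < +oo -> tempered f.
Proof.
move=> mf f2; split => // r.
have [_ /(_ (r + r)%N) c2] := tempered_cst hQ mB lB 1%R.
have mw := measurable_weight mB (r + r) (measurable_cst (1%R : R)).
apply: le_lt_trans (lte_add_pinfty f2 c2).
rewrite -ge0_integralD//; last 4 first.
- by move=> mu _; rewrite lee_fin sqr_ge0.
- by apply/measurable_EFinP; exact: measurable_funX.
- by move=> mu _; rewrite lee_fin (weight_ge0 B (cst 1%R)).
- exact/measurable_EFinP.
apply: ge0_le_integral => //.
- by move=> mu _; rewrite lee_fin weight_ge0.
- by apply/measurable_EFinP; exact: measurable_weight.
- apply: emeasurable_funD; last exact/measurable_EFinP.
  by apply/measurable_EFinP; exact: measurable_funX.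
move=> mu _; rewrite -EFinD lee_fin /= normr1 mul1r exprD.
set c := (_ ^+ r)%R; rewrite -(real_normK (num_real (f mu))).
have := sqr_ge0 (`|f mu| - c)%R; have := sqr_ge0 (`|f mu|)%R; have := sqr_ge0 c.
nra.
Qed.

Lemma tempered_finite_weighted f r : tempered f ->
  \int[Q]_mu (`|f mu| * (1 + num_points B mu) ^+ r * num_points B mu)%:E < +oo.
Proof.
move=> [mf /(_ r.+1)]; apply: le_lt_trans; apply: ge0_le_integral => //.
- by move=> mu _; rewrite lee_fin mulr_ge0 ?num_points_ge0 ?weight_ge0.
- apply/measurable_EFinP; apply: measurable_funM; last exact: measurable_num_points.
  exact: measurable_weight.
- by apply/measurable_EFinP; exact: measurable_weight.
- move=> mu _; rewrite lee_fin exprSr mulrA ler_wpM2l ?weight_ge0//.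
  by rewrite lerDr.
Qed.

Lemma measurable_integral_shift (g : N -> \bar R) : measurable_fun setT g ->
  (forall mu, 0 <= g mu) ->
  measurable_fun setT (fun x => \int[Q]_mu g (add_point (x, mu))).
Proof.
move=> mg g0.
apply: (@measurable_fun_fubini_tonelli_F _ _ X N R Q (fun z => g (add_point z))) => //.
exact: (measurableT_comp mg (@measurable_add_point _ X R)).
Qed.

(** The Mecke equation turns the mean of |f| (1+b)^r b, which is finite, into the
    integral over x in B of the means of the shifted functions, so almost all of
    these are finite. *)
Lemma ae_tempered_shift f : tempered f ->
  {ae lambda, forall x, B x -> tempered (fun mu => f (add_point (x, mu)))}.
Proof.
move=> fT; have mf := fT.1.
pose I r x := \int[Q]_mu (`|f (add_point (x, mu))| *
                          (1 + num_points B (add_point (x, mu))) ^+ r)%:E.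
have mI r : measurable_fun setT (I r).
  apply: (measurable_integral_shift
    (g := fun mu => (`|f mu| * (1 + num_points B mu) ^+ r)%:E)).
    by apply/measurable_EFinP; exact: measurable_weight.
  by move=> mu; rewrite lee_fin weight_ge0.
have I0 r x : 0 <= I r x.
  by apply: integral_ge0 => mu _; rewrite lee_fin weight_ge0.
have aeI : {ae lambda, forall x r, B x -> I r x \is a fin_num}.
  apply/ae_foralln => r; apply: integrable_ae => //.
  apply/integrableP; split; first exact: measurable_funTS.
  under eq_integral do rewrite gee0_abs//.
  rewrite -(ge0_mecke_num_points hQ mB lB (measurable_weight mB r mf))//.
    exact: tempered_finite_weighted.
  by move=> mu; rewrite weight_ge0.
apply: filterS aeI => x Ix Bx; split; first exact: measurable_shift.
move=> r; have := Ix r Bx; rewrite ge0_fin_numE//; apply: le_lt_trans.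
apply: (ge0_le_integral_finite_count hQ mB lB).
- by apply/measurable_EFinP; apply: measurable_weight => //; exact: measurable_shift.
- apply/measurable_EFinP.
  exact: (measurable_shift x (measurable_weight mB r mf)).
- by move=> mu; rewrite lee_fin mulr_ge0// count_weight_ge0.
- by move=> mu; rewrite lee_fin weight_ge0.
move=> mu muB; rewrite lee_fin ler_wpM2l// lerXn2r ?nnegrE ?addr_ge0 ?num_points_ge0//.
by rewrite num_points_add_point// lerD2l lerDr.
Qed.

Section subset.
Variable B' : set X.
Hypotheses (mB' : measurable B') (BB' : B' `<=` B).

Let lB' : lambda B' < +oo.
Proof. by apply: le_lt_trans lB; apply: le_measure; rewrite ?inE. Qed.

Lemma le_num_points mu : mu B < +oo -> (num_points B' mu <= num_points B mu)%R.
Proof.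
move=> muB; have muB' : mu B' <= mu B by apply: le_measure; rewrite ?inE.
by apply: fine_le => //; rewrite ge0_fin_numE//; exact: le_lt_trans muB.
Qed.

Lemma tempered_num_points f : tempered f ->
  tempered (fun mu => f mu * num_points B' mu)%R.
Proof.
move=> fT; have mf := fT.1; apply: (le_tempered hQ mB lB _ fT).
  by apply: measurable_funM => //; exact: measurable_num_points.
exists 1%R, 1%N; split => // mu muB.
rewrite mul1r expr1 normrM ler_wpM2l// ger0_norm ?num_points_ge0//.
by apply: (le_trans (le_num_points muB)); rewrite lerDr.
Qed.

Lemma tempered_funrpos f : tempered f -> tempered f^\+%R.
Proof.
move=> fT; have mf := fT.1; apply: (le_tempered hQ mB lB _ fT).
  exact: measurable_funrpos.
exists 1%R, 0%N; split => // mu _; rewrite mul1r expr0 mulr1.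
rewrite ger0_norm ?funrpos_ge0// /funrpos ge_max normr_ge0 andbT.
exact: ler_norm.
Qed.

Lemma tempered_funrneg f : tempered f -> tempered f^\-%R.
Proof.
move=> fT; have mf := fT.1; apply: (le_tempered hQ mB lB _ fT).
  exact: measurable_funrneg.
exists 1%R, 0%N; split => // mu _; rewrite mul1r expr0 mulr1.
rewrite ger0_norm ?funrneg_ge0// /funrneg ge_max normr_ge0 andbT.
by rewrite -normrN ler_norm.
Qed.

Lemma integrable_ge0_shift g : tempered g -> (forall mu, (0 <= g mu)%R) ->
  lambda.-integrable B' (fun x => \int[Q]_mu (g (add_point (x, mu)))%:E).
Proof.
move=> gT g0; have mg := gT.1; apply/integrableP; split.
  apply: measurable_funTS.
  apply: (measurable_integral_shift (g := EFin \o g)); first exact/measurable_EFinP.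
  by move=> mu; rewrite lee_fin.
under eq_integral.
  move=> x _; rewrite gee0_abs; last by apply: integral_ge0 => mu _; rewrite lee_fin.
  over.
rewrite -(ge0_mecke_num_points hQ mB' lB')//.
exact: (integrable_lty measurableT (tempered_integrable (tempered_num_points gT))).
Qed.

Lemma integral_shiftE f x : \int[Q]_mu (f (add_point (x, mu)))%:E =
  \int[Q]_mu (f^\+%R (add_point (x, mu)))%:E -
  \int[Q]_mu (f^\-%R (add_point (x, mu)))%:E.
Proof.
pose g mu := f (add_point (x, mu)).
rewrite -[LHS]/(\int[Q]_mu (EFin \o g) mu) integralE funerpos funerneg.
by [].
Qed.

Lemma integrable_shift f : tempered f ->
  lambda.-integrable B' (fun x => \int[Q]_mu (f (add_point (x, mu)))%:E).
Proof.
move=> fT; under eq_fun do rewrite integral_shiftE.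
apply: integrableB => //.
- by apply: integrable_ge0_shift; [exact: tempered_funrpos|exact: funrpos_ge0].
- by apply: integrable_ge0_shift; [exact: tempered_funrneg|exact: funrneg_ge0].
Qed.

(** The count of a subset B' of B is used because f is tempered with respect to B
    while the cells of a partition are only parts of B. *)
Lemma mecke_num_points f : tempered f ->
  \int[Q]_mu (f mu * num_points B' mu)%:E =
  \int[lambda]_(x in B') \int[Q]_mu (f (add_point (x, mu)))%:E.
Proof.
move=> fT; have mf := fT.1.
have fpT := tempered_funrpos fT; have fnT := tempered_funrneg fT.
under [RHS]eq_integral do rewrite integral_shiftE.
rewrite integralB//; last 2 first.
- by apply: integrable_ge0_shift; [|exact: funrpos_ge0].
- by apply: integrable_ge0_shift; [|exact: funrneg_ge0].
rewrite -(ge0_mecke_num_points hQ mB' lB' fpT.1 (funrpos_ge0 f)).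
rewrite -(ge0_mecke_num_points hQ mB' lB' fnT.1 (funrneg_ge0 f)).
have h g : tempered g ->
    Q.-integrable setT (EFin \o (fun mu => g mu * num_points B' mu)%R).
  by move=> gT; apply: tempered_integrable; exact: tempered_num_points.
rewrite -integralB_EFin//; last 2 first.
- exact: h.
- exact: h.
apply: eq_integral => mu _; rewrite -EFinB -mulrBl; congr (_ * _)%:E.
by rewrite -[in LHS](funrposBneg f).
Qed.

End subset.

Local Notation L := (fine (lambda B)).

(** Each integration over a point of B costs at most a factor lambda(B) + b: the
    term that adds the point contributes b by the Mecke equation, the other one
    contributes lambda(B). *)
Lemma le_integral_envelope n g : measurable_fun setT g ->
  (forall mu, (0 <= g mu)%R) ->
  \int[power_measure lambda n]_(t in box B n) \int[Q]_mu (envelope g t mu)%:E <=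
  \int[Q]_mu (g mu * (L + num_points B mu) ^+ n)%:E.
Proof.
have l0 : (0 <= L)%R by exact: fine_ge0.
have lBE : lambda B = L%:E by rewrite fineK// ge0_fin_numE.
move: l0 lBE; set l := L => l0 lBE.
elim: n g => [|n IH] g mg g0.
  rewrite (_ : box B 0 = setT); last by apply/seteqP; split => // t _ [].
  by rewrite integral_power0; under [leRHS]eq_integral do rewrite expr0 mulr1.
pose h t := \int[Q]_mu (envelope g (t : n.+1.-tuple X) mu)%:E.
have mh : measurable_fun setT h.
  apply: (@measurable_fun_fubini_tonelli_F _ _ (n.+1.-tuple X) N R Q
    (fun z => (envelope g z.1 z.2)%:E)).
    apply/measurable_EFinP; apply: measurable_envelope => //.
  by move=> z; rewrite lee_fin envelope_ge0.
rewrite (ge0_integral_boxS lambda mB mh); last first.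
  by move=> t; apply: integral_ge0 => mu _; rewrite lee_fin envelope_ge0.
pose w mu := ((l + num_points B mu) ^+ n)%R.
have w0 mu : (0 <= w mu)%R by rewrite exprn_ge0// addr_ge0// num_points_ge0.
have mw : measurable_fun setT w.
  by apply: measurable_funX; apply: measurable_funD => //; exact: measurable_num_points.
have mgw : measurable_fun setT (fun mu => g mu * w mu)%R by exact: measurable_funM.
have gw0 mu : (0 <= g mu * w mu)%R by rewrite mulr_ge0.
apply: (@le_trans _ _ (\int[lambda]_(x in B)
  (\int[Q]_mu (g (add_point (x, mu)) * w (add_point (x, mu)))%:E +
   \int[Q]_mu (g mu * w mu)%:E))).
  apply: ge0_le_integral => //.
  - move=> x _; apply: integral_ge0 => t _; apply: integral_ge0 => mu _.
    by rewrite lee_fin envelope_ge0.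
  - apply: measurable_funTS.
    apply: (measurable_integral_boxS lambda mB mh) => t.
    by apply: integral_ge0 => mu _; rewrite lee_fin envelope_ge0.
  - apply: measurable_funTS; apply: emeasurable_funD => //.
    apply: (measurable_integral_shift (g := fun mu => (g mu * w mu)%:E)).
      exact/measurable_EFinP.
    by move=> mu; rewrite lee_fin.
  - move=> x Bx; have hE (t : n.-tuple X) : h (tuple_cons (x, t)) =
        \int[Q]_mu (envelope (fun mu => g (add_point (x, mu)) + g mu) t mu)%:E.
      by rewrite -envelope_cons.
    under eq_integral do rewrite hE.
    apply: (le_trans (IH _ _ _)).
    - by apply: measurable_funD => //; exact: measurable_shift.
    - by move=> mu; rewrite addr_ge0.
    rewrite -ge0_integralD//; last 4 first.
    + by move=> mu _; rewrite lee_fin.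
    + apply/measurable_EFinP; exact: (measurable_shift x mgw).
    + by move=> mu _; rewrite lee_fin.
    + exact/measurable_EFinP.
    apply: (ge0_le_integral_finite_count hQ mB lB).
    + apply/measurable_EFinP/measurable_funM => //.
      by apply: measurable_funD => //; exact: measurable_shift.
    + apply: emeasurable_funD; last exact/measurable_EFinP.
      apply/measurable_EFinP; exact: (measurable_shift x mgw).
    + by move=> mu; rewrite lee_fin; apply: mulr_ge0; [exact: addr_ge0|exact: w0].
    + by move=> mu; rewrite adde_ge0// lee_fin.
    + move=> mu muB; rewrite -EFinD lee_fin mulrDl.
      apply: lerD => //; apply: ler_wpM2l => //.
      rewrite /w lerXn2r ?nnegrE ?addr_ge0 ?num_points_ge0//.
      by rewrite num_points_add_point// lerD2l lerDr.
rewrite ge0_integralD//; last 3 first.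
- by move=> x _; apply: integral_ge0 => mu _; rewrite lee_fin.
- apply: measurable_funTS.
  apply: (measurable_integral_shift (g := fun mu => (g mu * w mu)%:E)).
    exact/measurable_EFinP.
  by move=> mu; rewrite lee_fin.
- by move=> x _; apply: integral_ge0 => mu _; rewrite lee_fin.
rewrite -(ge0_mecke_num_points hQ mB lB mgw gw0) integral_cst//.
rewrite muleC [X in _ + X * _](_ : _ = l%:E)// -ge0_integralZl//; last 2 first.
- exact/measurable_EFinP.
- by move=> mu _; rewrite lee_fin.
rewrite -ge0_integralD//; last 4 first.
- by move=> mu _; rewrite lee_fin mulr_ge0// num_points_ge0.
- by apply/measurable_EFinP/measurable_funM => //; exact: measurable_num_points.
- by move=> mu _; rewrite mule_ge0 ?lee_fin.
- by apply: measurable_funeM; exact/measurable_EFinP.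
apply: ge0_le_integral => //.
- by move=> mu _; rewrite adde_ge0 ?mule_ge0 ?lee_fin ?mulr_ge0 ?num_points_ge0.
- apply: emeasurable_funD; last by apply: measurable_funeM; exact/measurable_EFinP.
  by apply/measurable_EFinP/measurable_funM => //; exact: measurable_num_points.
- apply/measurable_EFinP/measurable_funM => //; apply: measurable_funX.
  by apply: measurable_funD => //; exact: measurable_num_points.
- move=> mu _; rewrite -EFinM -EFinD lee_fin exprS /w.
  by rewrite le_eqVlt; apply/orP; left; apply/eqP; ring.
Qed.

End signed_mecke.

(** * Mean differences *)

Section mean_differences.
Local Open Scope ereal_scope.
Context d (X : measurableType d) (R : realType).
Local Notation N := (point_measure X R).
Variables (lambda : {sigma_finite_measure set X -> \bar R}) (Q : probability N R).
Implicit Types (f g : N -> R) (mu : N).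

(** Integrals with values in the extended reals are measurable in the parameter
    even where they are infinite or undefined, as differences of the integrals of
    the two parts. *)
Lemma measurable_integral_param d' (Y : measurableType d') (G : Y * N -> R) :
  measurable_fun setT G ->
  measurable_fun setT (fun y => \int[Q]_mu (G (y, mu))%:E).
Proof.
move=> mG.
have mp : measurable_fun setT (EFin \o G^\+%R).
  exact/measurable_EFinP/measurable_funrpos.
have mn : measurable_fun setT (EFin \o G^\-%R).
  exact/measurable_EFinP/measurable_funrneg.
rewrite (_ : (fun y => _) = (fun y => \int[Q]_mu (G^\+%R (y, mu))%:E -
                             \int[Q]_mu (G^\-%R (y, mu))%:E)).
  apply: emeasurable_funB.
    by apply: (measurable_fun_fubini_tonelli_F (EFin \o G^\+%R)) => // z;
      rewrite lee_fin funrpos_ge0.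
  by apply: (measurable_fun_fubini_tonelli_F (EFin \o G^\-%R)) => // z;
      rewrite lee_fin funrneg_ge0.
apply/funext => y; pose g mu := G (y, mu).
by rewrite -[LHS]/(\int[Q]_mu (EFin \o g) mu) integralE funerpos funerneg.
Qed.

(** The kernels u_n of the chaos expansion, up to the factor n!, for all n at
    once. *)
Definition mean_diff f (t : seq X) : \bar R := \int[Q]_mu (diff f t mu)%:E.

Lemma mean_diff_cons f x t :
  mean_diff f (x :: t) = mean_diff (fun mu => f (add_point (x, mu)) - f mu)%R t.
Proof. by rewrite /mean_diff diff_cons. Qed.

Lemma measurable_mean_diff n f : measurable_fun setT f ->
  measurable_fun setT (fun t : n.-tuple X => mean_diff f t).
Proof.
move=> mf.
by apply: (measurable_integral_param (G := fun z : n.-tuple X * N => diff f z.1 z.2));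
  exact: measurable_diff.
Qed.

Lemma measurable_mean_envelope n g : measurable_fun setT g ->
  (forall mu, (0 <= g mu)%R) ->
  measurable_fun setT (fun t : n.-tuple X => \int[Q]_mu (envelope g t mu)%:E).
Proof.
move=> mg g0.
by apply: (measurable_integral_param (G := fun z : n.-tuple X * N => envelope g z.1 z.2));
  exact: measurable_envelope.
Qed.

Hypothesis hQ : poisson_counts lambda Q.
Variable B : set X.
Hypotheses (mB : measurable B) (lB : lambda B < +oo).

Lemma integrable_mean_envelope n f : tempered Q B f ->
  (power_measure lambda n).-integrable (box B n)
    (fun t => \int[Q]_mu (envelope (fun mu => `|f mu|%R) t mu)%:E).
Proof.
move=> fT; have mf : measurable_fun setT (fun mu => `|f mu|%R).
  by apply: measurableT_comp => //; exact: fT.1.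
apply/integrableP; split.
  by apply: measurable_funTS; exact: measurable_mean_envelope.
under eq_integral.
  move=> t _; rewrite gee0_abs; last first.
    by apply: integral_ge0 => mu _; rewrite lee_fin envelope_ge0.
  over.
apply: le_lt_trans (le_integral_envelope hQ mB lB n mf (fun mu => normr_ge0 _)) _.
set L := fine (lambda B); have L0 : (0 <= L)%R by exact: fine_ge0.
have [_ /(_ n) fn] := fT.
apply: (@le_lt_trans _ _ (((1 + L) ^+ n)%:E *
  \int[Q]_mu (`|f mu| * (1 + num_points B mu) ^+ n)%:E)); last first.
  by apply: lte_mul_pinfty => //; rewrite lee_fin exprn_ge0// addr_ge0.
have mw := measurable_weight mB n fT.1.
rewrite -ge0_integralZl//; last 3 first.
- exact/measurable_EFinP.
- by move=> mu _; rewrite lee_fin weight_ge0.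
- by rewrite lee_fin exprn_ge0// addr_ge0.
apply: ge0_le_integral => //.
- move=> mu _; rewrite lee_fin mulr_ge0// exprn_ge0// addr_ge0//.
  exact: num_points_ge0.
- apply/measurable_EFinP/measurable_funM => //; apply: measurable_funX.
  by apply: measurable_funD => //; exact: measurable_num_points.
- by apply: measurable_funeM; exact/measurable_EFinP.
move=> mu _; rewrite -EFinM lee_fin mulrCA ler_wpM2l// -exprMn.
have b0 := num_points_ge0 B mu.
by rewrite lerXn2r ?nnegrE ?mulr_ge0 ?addr_ge0//; nra.
Qed.

Lemma integrable_mean_diff n f : tempered Q B f ->
  (power_measure lambda n).-integrable (box B n)
    (fun t : n.-tuple X => mean_diff f t).
Proof.
move=> fT; apply: le_integrable (integrable_mean_envelope n fT).
- exact: measurable_box.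
- by apply: measurable_funTS; apply: measurable_mean_diff; exact: fT.1.
move=> t _; have md : measurable_fun setT (diff f t).
  by apply: (measurable_diff (m := id) (t := fun=> t)) => //; exact: fT.1.
have me : measurable_fun setT (envelope (fun mu => `|f mu|%R) t).
  apply: (measurable_envelope (m := id) (t := fun=> t)) => //.
  by apply: measurableT_comp => //; exact: fT.1.
apply: (le_trans (le_abse_integral _ _ _)) => //; first exact/measurable_EFinP.
rewrite [leRHS]gee0_abs; last first.
  by apply: integral_ge0 => mu _; rewrite lee_fin envelope_ge0.
apply: ge0_le_integral => //.
- by apply: measurableT_comp => //; exact/measurable_EFinP.
- exact/measurable_EFinP.
- by move=> mu _; rewrite lee_fin normr_diff_le.
Qed.

End mean_differences.

(** * Multiple integrals as polynomials in the cell counts *)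

Section discrete_chaos.
Context (R : realFieldType) (T : finType) (S : {pred T}) (l : T -> R).
Implicit Types (c : T -> R) (h : seq T -> R) (p : (T -> R) -> R).

Definition add_cell j c : T -> R := fun i => c i + (i == j)%:R.
Definition sub_cell j c : T -> R := fun i => c i - (i == j)%:R.

Lemma add_cellK j c : sub_cell j (add_cell j c) = c.
Proof. by apply/funext => i; rewrite /sub_cell /add_cell addrK. Qed.

Lemma sub_add_cellC i j c : sub_cell i (add_cell j c) = add_cell j (sub_cell i c).
Proof. by apply/funext => k; rewrite /sub_cell /add_cell addrAC. Qed.

(** Only the cells labelled in S, those inside B, may occur; the other cells can
    have infinite measure. *)
Inductive polynomial_in_cells : ((T -> R) -> R) -> Prop :=
| cell_poly_cst a : polynomial_in_cells (fun=> a)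
| cell_poly_var j : j \in S -> polynomial_in_cells (fun c => c j)
| cell_polyD p q : polynomial_in_cells p -> polynomial_in_cells q ->
    polynomial_in_cells (fun c => p c + q c)
| cell_polyM p q : polynomial_in_cells p -> polynomial_in_cells q ->
    polynomial_in_cells (fun c => p c * q c).

Lemma cell_poly_sub_cell j p : polynomial_in_cells p ->
  polynomial_in_cells (fun c => p (sub_cell j c)).
Proof.
elim=> [a|i iS|p1 p2 _ IH1 _ IH2|p1 p2 _ IH1 _ IH2].
- exact: cell_poly_cst.
- by apply: cell_polyD; [exact: cell_poly_var|exact: cell_poly_cst].
- exact: cell_polyD.
- exact: cell_polyM.
Qed.

Lemma cell_poly_sum (I : Type) (s : seq I) (P : pred I) (F : I -> (T -> R) -> R) :
  (forall i, P i -> polynomial_in_cells (F i)) ->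
  polynomial_in_cells (fun c => \sum_(i <- s | P i) F i c).
Proof.
move=> hF; elim: s => [|i s IH].
  have -> : (fun c => \sum_(i <- [::] | P i) F i c) = (fun=> 0).
    by apply/funext => c; rewrite big_nil.
  exact: cell_poly_cst.
have -> : (fun c => \sum_(i <- i :: s | P i) F i c) =
    (fun c => (if P i then F i c else 0) + \sum_(i <- s | P i) F i c).
  by apply/funext => c; rewrite big_cons; case: ifP => // _; rewrite add0r.
by apply: cell_polyD => //; case Pi : (P i); [exact: hF|exact: cell_poly_cst].
Qed.

Lemma cell_poly_adjoint j p : j \in S -> polynomial_in_cells p ->
  polynomial_in_cells (fun c => c j * p (sub_cell j c) - l j * p c).
Proof.
move=> jS pP; apply: cell_polyD.
  by apply: cell_polyM; [exact: cell_poly_var|exact: cell_poly_sub_cell].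
under eq_fun do rewrite -mulNr.
by apply: cell_polyM; [exact: cell_poly_cst|exact: pP].
Qed.

Definition slice j h : seq T -> R := fun s => h (j :: s).

(** The n-fold integral of the kernel h against the compensated counts c_j - l_j,
    without diagonal terms. The point used for the first coordinate is removed
    from the counts before the next one is read, so that no point is used
    twice. *)
Fixpoint chaos n h c : R :=
  if n is n'.+1 then
    \sum_(j in S) (c j * chaos n' (slice j h) (sub_cell j c)
                   - l j * chaos n' (slice j h) c)
  else h [::].

Arguments chaos : simpl never.

Lemma chaosS n h c : chaos n.+1 h c =
  \sum_(j in S) (c j * chaos n (slice j h) (sub_cell j c)
                 - l j * chaos n (slice j h) c).
Proof. by []. Qed.

Lemma chaos_polynomial n h : polynomial_in_cells (chaos n h).
Proof.
elim: n h => [|n IH] h; first exact: cell_poly_cst.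
by apply: cell_poly_sum => j jS; exact: (cell_poly_adjoint jS (IH _)).
Qed.

(** The kernel h with the coordinate of index r frozen to j. *)
Definition insert_at r j h : seq T -> R :=
  fun s => h (take r s ++ j :: drop r s).

Lemma insert_at0 j h : insert_at 0 j h = slice j h.
Proof. by apply/funext => s; rewrite /insert_at take0 drop0. Qed.

Lemma slice_insert_atS r i j h :
  slice i (insert_at r.+1 j h) = insert_at r j (slice i h).
Proof. by []. Qed.

Let sum_delta (F : T -> R) j : j \in S ->
  \sum_(i in S) (i == j)%:R * F i = F j.
Proof.
move=> jS; rewrite (bigD1 j)//= eqxx mul1r big1 ?addr0// => i /andP[_ /negbTE ->].
by rewrite mul0r.
Qed.

(** Adding a point to the cell j lets it serve as any one of the n + 1 coordinates
    and changes nothing else. For a symmetric kernel this is the familiar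
    D I_{n+1}(h) = (n+1) I_n(h_j). *)
Lemma chaos_difference n h j c : j \in S ->
  chaos n.+1 h (add_cell j c) - chaos n.+1 h c =
  \sum_(r < n.+1) chaos n (insert_at r j h) c.
Proof.
move=> jS; elim: n h c => [|n IH] h c.
  rewrite big_ord1 insert_at0 !chaosS /chaos -sumrB (bigD1 j)//= big1 ?addr0.
    by rewrite /add_cell eqxx mulr1n /slice; ring.
  by move=> i /andP[_ /negbTE ij]; rewrite /add_cell ij mulr0n /slice; ring.
rewrite big_ord_recl insert_at0.
have -> : \sum_(r < n.+1) chaos n.+1 (insert_at (lift ord0 r) j h) c =
    \sum_(i in S) (c i * (chaos n.+1 (slice i h) (add_cell j (sub_cell i c))
                          - chaos n.+1 (slice i h) (sub_cell i c))
                   - l i * (chaos n.+1 (slice i h) (add_cell j c)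
                            - chaos n.+1 (slice i h) c)).
  under [RHS]eq_bigr do rewrite !IH !mulr_sumr -sumrB.
  rewrite exchange_big /=; apply: eq_bigr => r _.
  by apply: eq_bigr => i _; rewrite slice_insert_atS.
rewrite !(chaosS n.+1).
have -> : chaos n.+1 (slice j h) c =
    \sum_(i in S) (i == j)%:R * chaos n.+1 (slice i h) (sub_cell i (add_cell j c)).
  by rewrite sum_delta// add_cellK.
rewrite -sumrB -big_split; apply: eq_bigr => i _ /=.
rewrite sub_add_cellC {1}/add_cell; ring.
Qed.

(** The squared L^2 norm of h, for the cell weights l, by the same recursion on
    the first coordinate as chaos. *)
Fixpoint sqnorm n h : R :=
  if n is n'.+1 then \sum_(j in S) l j * sqnorm n' (slice j h) else h [::] ^+ 2.

Arguments sqnorm : simpl never.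

Lemma sqnormS n h : sqnorm n.+1 h = \sum_(j in S) l j * sqnorm n (slice j h).
Proof. by []. Qed.

(** Integrating out the coordinate of index r first or last gives the same norm. *)
Lemma sqnorm_insert_at n r h : (r <= n)%N ->
  \sum_(j in S) l j * sqnorm n (insert_at r j h) = sqnorm n.+1 h.
Proof.
elim: n r h => [|n IH] [|r] h //.
rewrite ltnS => rn.
transitivity (\sum_(j in S) \sum_(i in S)
    l i * (l j * sqnorm n (insert_at r j (slice i h)))).
  apply: eq_bigr => j _; rewrite sqnormS mulr_sumr; apply: eq_bigr => i _.
  by rewrite slice_insert_atS mulrCA.
rewrite exchange_big; apply: eq_bigr => i _ /=.
by rewrite -mulr_sumr IH.
Qed.

End discrete_chaos.
Arguments chaos {R T} S l n h c : simpl never.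
Arguments sqnorm {R T} S l n h : simpl never.

(** * Multiple integrals against the Poisson process *)

Section integral_finite_sum.
Local Open Scope ereal_scope.
Context d (T : measurableType d) (R : realType) (mu : {measure set T -> \bar R}).

Lemma integral_sum_in (I : finType) (S : {pred I}) (F : I -> T -> \bar R) :
  (forall i, i \in S -> mu.-integrable setT (F i)) ->
  \int[mu]_x (\sum_(i in S) F i x) = \sum_(i in S) \int[mu]_x F i x.
Proof.
move=> iF; pose G i := if i \in S then F i else cst 0.
have iG i : mu.-integrable setT (G i).
  by rewrite /G; case: ifPn => iS; [exact: iF|exact: integrable0].
transitivity (\int[mu]_x (\sum_(i in S) G i x)).
  by apply: eq_integral => x _; apply: eq_bigr => i iS; rewrite /G iS.
by rewrite integral_sum//; apply: eq_bigr => i iS; rewrite /G iS.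
Qed.

End integral_finite_sum.

Section grid_chaos.
Local Open Scope ereal_scope.
Context d (X : measurableType d) (R : realType).
Local Notation N := (point_measure X R).
Variables (lambda : {sigma_finite_measure set X -> \bar R}) (Q : probability N R).
Hypothesis hQ : poisson_counts lambda Q.
Variables (T : finType) (kappa : X -> T) (S : {pred T}).
Hypothesis mk : measurable_cells kappa.
Let B := kappa @^-1` [set` S].
Hypothesis lB : lambda B < +oo.
Local Notation cell j := (kappa @^-1` [set j]).
Local Notation l := (fun j : T => fine (lambda (cell j))).
Local Notation tempered := (tempered Q B).
Implicit Types (f : N -> R) (mu : N) (p : (T -> R) -> R) (h : seq T -> R).

Let mB : measurable B. Proof. exact: measurable_cellsE. Qed.

(** The counts as real numbers; a count equal to +oo is read as 0, which concerns
    a null set for the cells inside B. *)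
Definition cells mu : T -> R := fun j => num_points (cell j) mu.

Let cell_sub j : j \in S -> cell j `<=` B.
Proof. by move=> jS x xj; rewrite /B /= xj. Qed.

Let lcell j : j \in S -> lambda (cell j) < +oo.
Proof.
move=> jS; apply: le_lt_trans lB; apply: le_measure; rewrite ?inE//.
exact: cell_sub.
Qed.

Let lcellE j : j \in S -> lambda (cell j) = (l j)%:E.
Proof. by move=> jS; rewrite fineK// ge0_fin_numE// lcell. Qed.

Lemma cells_add_point x mu : B x -> mu B < +oo ->
  cells (add_point (x, mu)) = add_cell (kappa x) (cells mu).
Proof.
move=> Bx muB; apply/funext => i; rewrite /cells /add_cell.
have [iS|iS] := boolP (i \in S).
  rewrite num_points_add_point//; last first.
    by apply: le_lt_trans muB; apply: le_measure; rewrite ?inE//; exact: cell_sub.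
  rewrite addrC indicE; congr (_ + _%:R)%R; congr nat_of_bool.
  by apply/idP/eqP => [/set_mem //|->]; exact: mem_set.
have ik : i != kappa x by apply: contraNneq iS => ->.
rewrite /num_points add_pointE indicE memNset ?add0e ?(negbTE ik) ?addr0//=.
by move=> e; rewrite e eqxx in ik.
Qed.

Lemma tempered_polynomial f p : tempered f -> polynomial_in_cells S p ->
  tempered (fun mu => f mu * p (cells mu))%R.
Proof.
move=> fT pP; elim: pP f fT => [a|j jS|p1 p2 _ IH1 _ IH2|p1 p2 _ IH1 _ IH2] f fT.
- rewrite (_ : (fun mu => _) = (fun mu => a * f mu)%R).
    exact: (temperedZ hQ mB lB).
  by apply/funext => mu; rewrite mulrC.
- exact: (tempered_num_points hQ mB lB (mk j) (cell_sub jS) fT).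
- rewrite (_ : (fun mu => _) =
    (fun mu => f mu * p1 (cells mu) + f mu * p2 (cells mu))%R).
    exact: (temperedD mB (IH1 _ fT) (IH2 _ fT)).
  by apply/funext => mu; rewrite mulrDr.
- rewrite (_ : (fun mu => _) =
    (fun mu => f mu * p1 (cells mu) * p2 (cells mu))%R).
    exact: (IH2 _ (IH1 _ fT)).
  by apply/funext => mu; rewrite mulrA.
Qed.

Let tempered1 : tempered (cst 1%R).
Proof. exact: (tempered_cst hQ mB lB). Qed.

Lemma tempered_poly p : polynomial_in_cells S p -> tempered (fun mu => p (cells mu)).
Proof.
move=> pP.
rewrite (_ : (fun mu => _) = (fun mu => cst 1 mu * p (cells mu))%R).
  exact: tempered_polynomial tempered1 pP.
by apply/funext => mu; rewrite /= mul1r.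
Qed.

(** The scalar product of D_x f with p, as a function of x. *)
Definition gradient_pairing f p x :=
  \int[Q]_mu ((f (add_point (x, mu)) - f mu) * p (cells mu))%:E.

Local Notation G := gradient_pairing.

Let C f p := \int[Q]_mu (f mu * p (cells mu))%:E.

Let f' f p j mu := (f mu * p (sub_cell j (cells mu)))%R.

Let tempered_f' f p j : tempered f -> polynomial_in_cells S p -> tempered (f' f p j).
Proof.
by move=> fT pP; exact: (tempered_polynomial fT (cell_poly_sub_cell j pP)).
Qed.

Let C_fin f p : tempered f -> polynomial_in_cells S p -> C f p \is a fin_num.
Proof.
move=> fT pP; have iF := tempered_integrable (tempered_polynomial fT pP).
exact: (integrable_fin_num measurableT iF).
Qed.

Let measurable_G f p : tempered f -> polynomial_in_cells S p -> measurable_fun setT (G f p).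
Proof.
move=> fT pP; apply: (measurable_integral_param Q
  (G := fun z => ((f (add_point z) - f z.2) * p (cells z.2))%R)).
apply: measurable_funM.
  apply: measurable_funB.
    exact: (measurableT_comp fT.1 (@measurable_add_point _ X R)).
  exact: (measurableT_comp fT.1 (@measurable_snd _ _ X N)).
exact: (measurableT_comp (tempered_poly pP).1 (@measurable_snd _ _ X N)).
Qed.

(** For almost every x the two terms of D_x f are separately integrable against
    p. The point x is absorbed by evaluating p at the counts without it. *)
Let ae_GE f p j : tempered f -> polynomial_in_cells S p -> j \in S ->
  {ae lambda, forall x, cell j x ->
    G f p x = \int[Q]_mu (f' f p j (add_point (x, mu)))%:E - C f p}.
Proof.
move=> fT pP jS; have := ae_tempered_shift hQ mB lB fT.
apply: filterS => x fxT xj; have Bx : B x by exact: (cell_sub jS xj).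
have {}fxT := fxT Bx.
rewrite (_ : \int[Q]_mu (f' f p j (add_point (x, mu)))%:E =
    \int[Q]_mu (f (add_point (x, mu)) * p (cells mu))%:E); last first.
  apply: (eq_integral_finite_count hQ mB lB).
  - apply/measurable_EFinP.
    exact: (measurable_shift x (tempered_f' j fT pP).1).
  - apply/measurable_EFinP; exact: (tempered_polynomial fxT pP).1.
  - by move=> mu muB; rewrite /f' cells_add_point// xj add_cellK.
rewrite /G /C -integralB_EFin//; last 2 first.
- exact: (tempered_integrable (tempered_polynomial fxT pP)).
- exact: (tempered_integrable (tempered_polynomial fT pP)).
by apply: eq_integral => mu _; rewrite -EFinB -mulrBl.
Qed.

Lemma integrable_shift_diff f p j : tempered f -> polynomial_in_cells S p ->
  j \in S -> lambda.-integrable (cell j) (G f p).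
Proof.
move=> fT pP jS; have mj := mk j.
have h : lambda.-integrable (cell j)
    (fun x => \int[Q]_mu (f' f p j (add_point (x, mu)))%:E - C f p).
  apply: integrableB => //.
    apply: (integrable_shift hQ mB lB mj (cell_sub jS)); exact: tempered_f'.
  rewrite -(fineK (C_fin fT pP)); apply/integrableP; split => //.
  by rewrite integral_cst// lte_mul_pinfty// ?lcell.
apply/integrableP; split; first by apply: measurable_funTS; exact: measurable_G.
case/integrableP : h => mh; apply: le_lt_trans.
rewrite le_eqVlt; apply/orP; left; apply/eqP; apply: ae_eq_integral => //.
- by apply: measurableT_comp => //; apply: measurable_funTS; exact: measurable_G.
- exact: measurableT_comp.
- by apply: filterS (ae_GE fT pP jS) => x /[apply] ->.
Qed.

(** The operator p |-> c_j p(c - e_j) - l_j p is adjoint to the difference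
    operator integrated over the cell j: by the Mecke equation the first term is the
    integral of the shifted part, and l_j is the mass of the cell. *)
Lemma cell_adjoint f p j : tempered f -> polynomial_in_cells S p -> j \in S ->
  \int[Q]_mu (f mu * (cells mu j * p (sub_cell j (cells mu))
                      - l j * p (cells mu)))%:E =
  \int[lambda]_(x in cell j) G f p x.
Proof.
move=> fT pP jS; have mj := mk j.
have f'T := tempered_f' j fT pP.
have iF' : lambda.-integrable (cell j)
    (fun x => \int[Q]_mu (f' f p j (add_point (x, mu)))%:E).
  exact: (integrable_shift hQ mB lB mj (cell_sub jS)).
have iC : lambda.-integrable (cell j) (fun=> C f p).
  rewrite -(fineK (C_fin fT pP)); apply/integrableP; split => //.
  by rewrite integral_cst// lte_mul_pinfty// ?lcell.
rewrite (ae_eq_integral (fun x =>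
   \int[Q]_mu (f' f p j (add_point (x, mu)))%:E - C f p)) => //; last 3 first.
- by apply: measurable_funTS; exact: measurable_G.
- by apply: emeasurable_funB; [exact: measurable_int iF'|exact: measurable_int iC].
- exact: ae_GE.
rewrite integralB// integral_cst//.
rewrite -(mecke_num_points hQ mB lB mj (cell_sub jS) f'T).
rewrite (eq_integral (fun mu => (f' f p j mu * num_points (cell j) mu)%:E -
   (l j * (f mu * p (cells mu)))%:E)); last first.
  by move=> mu _; rewrite -EFinB /f'; congr (_%:E); rewrite /cells; ring.
rewrite integralB_EFin//; last 2 first.
- exact: (tempered_integrable
    (tempered_num_points hQ mB lB mj (cell_sub jS) f'T)).
- exact: (tempered_integrable
    (temperedZ hQ mB lB (l j) (tempered_polynomial fT pP))).
congr (_ - _); under eq_integral do rewrite EFinM.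
rewrite integralZl//; last exact: (tempered_integrable (tempered_polynomial fT pP)).
by rewrite muleC -lcellE.
Qed.

Let patch_cell_sum (g : T -> X -> \bar R) x :
  \sum_(j in S) (g j \_ (cell j)) x = if kappa x \in S then g (kappa x) x else 0.
Proof.
case: ifPn => kS; last first.
  rewrite big1// => j jS; rewrite patchE memNset//= => kj.
  by rewrite kj jS in kS.
rewrite (bigD1 (kappa x))//= big1 ?adde0; first by rewrite patchE mem_set.
by move=> j /andP[_ jk]; rewrite patchE memNset//= => kj; rewrite kj eqxx in jk.
Qed.

Let integral_cells (g : T -> X -> \bar R) :
  (forall j, j \in S -> lambda.-integrable (cell j) (g j)) ->
  \sum_(j in S) \int[lambda]_(x in cell j) g j x =
  \int[lambda]_x \sum_(j in S) (g j \_ (cell j)) x.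
Proof.
move=> ig; rewrite integral_sum_in.
  by apply: eq_bigr => j _; rewrite [LHS]integral_mkcond.
by move=> j jS; apply/(integrable_mkcond _ (mk j)); exact: ig.
Qed.

(** Kernels that vanish when a coordinate leaves B, so that the integrals over
    X^n are integrals over the box B^n. *)
Definition supported h := forall s, ~~ all [in S] s -> h s = 0%R.

Let supported_slice h j : supported h -> supported (slice j h).
Proof. by move=> hS s sS; apply: hS; rewrite /= negb_and sS orbT. Qed.

Let slice_out h j : supported h -> j \notin S -> slice j h = fun=> 0%R.
Proof. by move=> hS jS; apply/funext => s; apply: hS; rewrite /= (negbTE jS). Qed.

Let map_kappa n (t : n.-tuple X) : n.-tuple T := [tuple of map kappa t].

Lemma measurable_grid n h :
  measurable_fun setT (fun t : n.-tuple X => h (map kappa t)).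
Proof.
move=> _ Y mY; rewrite setTI.
rewrite (_ : _ @^-1` _ = \bigcup_(s in [set s : n.-tuple T | Y (h s)])
   \bigcap_(i in [set: 'I_n]) ((@tnth n X ^~ i) @^-1` cell (tnth s i))).
  apply: fin_bigcup_measurable => // s _.
  apply: fin_bigcap_measurable => // i _.
  rewrite -[X in measurable X]setTI.
  exact: (@measurable_tnth _ X n i measurableT _ (mk _)).
apply/seteqP; split => t /=.
  move=> Yt; exists (map_kappa t) => // i _ /=.
  by rewrite /map_kappa tnth_map.
move=> [s Ys ts]; rewrite (_ : map kappa t = s)//.
rewrite -[LHS]/(tval (map_kappa t)); congr tval.
by apply: eq_from_tnth => i; rewrite tnth_map; exact: ts.
Qed.

Lemma bounded_grid n h : exists2 M : R, (0 <= M)%R &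
  forall t : n.-tuple X, (`|h (map kappa t)| <= M)%R.
Proof.
exists (\sum_(s : n.-tuple T) `|h s|)%R; first exact: sumr_ge0.
move=> t; rewrite (bigD1 (map_kappa t))//= lerDl.
exact: sumr_ge0.
Qed.

Lemma supported_box n h (t : n.-tuple X) : supported h ->
  h (map kappa t) != 0%R -> box B n t.
Proof.
move=> hS h0 i; have : all [in S] (map kappa t).
  by apply/negPn/negP => /hS /eqP; rewrite (negbTE h0).
by move=> /allP/(_ (kappa (tnth t i))); apply; rewrite map_f// mem_tnth.
Qed.

Lemma integrable_grid n f h : tempered f -> supported h ->
  (power_measure lambda n).-integrable setT
    (fun t : n.-tuple X => (h (map kappa t))%:E * mean_diff Q f t).
Proof.
move=> fT hS; have [M M0 hM] := bounded_grid n h.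
have mf := measurable_mean_diff Q (n := n) fT.1.
have iB := (integrable_mkcond _ (@measurable_box _ X B mB n)).1
  (integrable_mean_diff hQ mB lB n fT).
apply: (le_integrable measurableT _ _ (integrableZl measurableT M iB)).
- apply: emeasurable_funM => //.
  by apply/measurable_EFinP; exact: measurable_grid.
move=> t _; have [->|h0] := eqVneq (h (map kappa t)) 0%R.
  by rewrite mul0e abse0 abse_ge0.
rewrite patchE mem_set; last exact: supported_box h0.
by rewrite !abseM lee_wpmul2r//= lee_fin (ger0_norm M0).
Qed.

(** The recursion for chaos removes the first coordinate of h; by cell_adjoint its
    value is paired with the difference of f in that point, and the induction
    hypothesis applies to D_x f for almost every x. *)
Lemma chaos_duality n f h : tempered f -> supported h ->
  \int[Q]_mu (f mu * chaos S l n h (cells mu))%:E =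
  \int[power_measure lambda n]_t ((h (map kappa t))%:E * mean_diff Q f t).
Proof.
elim: n f h => [|n IH] f h fT hS.
  rewrite integral_power0 /= /chaos /mean_diff /=.
  have iF : Q.-integrable setT (EFin \o f) by exact: tempered_integrable fT.
  under eq_integral do rewrite EFinM.
  by rewrite integralZr// muleC.
have pP j := chaos_polynomial S l n (slice j h).
rewrite (eq_integral (fun mu => \sum_(j in S)
   (f mu * (cells mu j * chaos S l n (slice j h) (sub_cell j (cells mu)) -
            l j * chaos S l n (slice j h) (cells mu)))%:E)); last first.
  by move=> mu _; rewrite chaosS mulr_sumr sumEFin.
have iA j : j \in S -> Q.-integrable setT (fun mu =>
   (f mu * (cells mu j * chaos S l n (slice j h) (sub_cell j (cells mu)) -
            l j * chaos S l n (slice j h) (cells mu)))%:E).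
  move=> jS; apply: (tempered_integrable (B := B)).
  apply: (tempered_polynomial (p := fun c => (c j * chaos S l n (slice j h)
     (sub_cell j c) - l j * chaos S l n (slice j h) c)%R) fT).
  exact: (cell_poly_adjoint l jS (pP j)).
rewrite (integral_sum_in iA).
under eq_bigr => j jS do rewrite (cell_adjoint fT (pP j) jS).
rewrite (integral_cells (g := fun j => G f (chaos S l n (slice j h)))); last first.
  by move=> j jS; exact: integrable_shift_diff.
have iF := integrable_grid n.+1 fT hS.
rewrite (integral_powerS iF); apply: ae_eq_integral => //.
- under eq_fun do rewrite -big_filter.
  apply: emeasurable_sum => j.
  apply/(measurable_restrictT _ (mk j)).1; apply: measurable_funTS.
  exact: measurable_G.
- exact: (measurable_integral_powerS iF).
have := ae_tempered_shift hQ mB lB fT; apply: filterS => x fxT _.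
rewrite patch_cell_sum; case: ifPn => kS; last first.
  apply/esym/integral0_eq => t _; rewrite /tuple_cons /=.
  by rewrite -[h _]/(slice (kappa x) h (map kappa t)) slice_out// mul0e.
have Bx : B x by [].
have dT : tempered (fun mu => f (add_point (x, mu)) - f mu)%R.
  by apply: (temperedB hQ mB lB) => //; exact: fxT.
rewrite /gradient_pairing (IH _ _ dT (supported_slice _ hS)).
by apply: eq_integral => t _; rewrite -mean_diff_cons.
Qed.

Let integrable_poly p : polynomial_in_cells S p ->
  Q.-integrable setT (EFin \o (fun mu => p (cells mu))).
Proof. by move=> pP; exact: (tempered_integrable (tempered_poly pP)). Qed.

Let E p := (\int[Q]_mu p (cells mu))%R.

Let E_EFin p : polynomial_in_cells S p -> \int[Q]_mu (p (cells mu))%:E = (E p)%:E.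
Proof.
move=> pP; have /= pF := integrable_fin_num measurableT (integrable_poly pP).
by rewrite /E /Rintegral fineK.
Qed.

Let E_sum (I : finType) (P : {pred I}) (q : I -> (T -> R) -> R) :
  (forall i, i \in P -> polynomial_in_cells S (q i)) ->
  E (fun c => \sum_(i in P) q i c)%R = (\sum_(i in P) E (q i))%R.
Proof.
move=> qP; apply: EFin_inj; rewrite -E_EFin; last exact: cell_poly_sum.
transitivity (\int[Q]_mu \sum_(i in P) (q i (cells mu))%:E).
  by apply: eq_integral => mu _; rewrite sumEFin.
rewrite integral_sum_in; last by move=> i iP; exact: (integrable_poly (qP i iP)).
by rewrite -sumEFin; apply: eq_bigr => i iP; rewrite E_EFin//; exact: qP.
Qed.

Let E_le p q : polynomial_in_cells S p -> polynomial_in_cells S q ->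
  (forall c, p c <= q c)%R -> (E p <= E q)%R.
Proof.
move=> pP qP pq; rewrite -lee_fin -!E_EFin//.
by apply: le_integral => //; [exact: integrable_poly|exact: integrable_poly|
  move=> mu _; rewrite lee_fin].
Qed.

Let EZ a p : polynomial_in_cells S p -> E (fun c => a * p c)%R = (a * E p)%R.
Proof. by move=> pP; rewrite /E RintegralZl//; exact: integrable_poly. Qed.

Let ED p q : polynomial_in_cells S p -> polynomial_in_cells S q ->
  E (fun c => p c + q c)%R = (E p + E q)%R.
Proof. by move=> pP qP; rewrite /E RintegralD//; exact: integrable_poly. Qed.

(** The case where f is a multiple integral: its difference is constant
    on the cell j, so that the integral over the cell is a factor l_j. *)
Let E_cell_adjoint n h p j : polynomial_in_cells S p -> j \in S ->
  E (fun c => chaos S l n.+1 h c *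
       (c j * p (sub_cell j c) - l j * p c))%R =
  (l j * E (fun c => (\sum_(r < n.+1) chaos S l n (insert_at r j h) c) * p c))%R.
Proof.
move=> pP jS; have zP := chaos_polynomial S l n.+1 h.
have sP : polynomial_in_cells S
    (fun c => (\sum_(r < n.+1) chaos S l n (insert_at r j h) c) * p c)%R.
  apply: cell_polyM => //; apply: cell_poly_sum => r _; exact: chaos_polynomial.
set e := E (fun c => _ * p c)%R.
rewrite [LHS]/E /Rintegral (cell_adjoint (tempered_poly zP) pP jS).
have -> : \int[lambda]_(x in cell j) G (fun mu => chaos S l n.+1 h (cells mu)) p x
    = \int[lambda]_(x in cell j) cst e%:E x; last first.
  rewrite integral_cst// fineM//; first by rewrite mulrC.
  by rewrite ge0_fin_numE// lcell.
apply: eq_integral => x /set_mem xj; rewrite /= /e -E_EFin//.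
have Bx : B x by exact: (cell_sub jS xj).
apply: (eq_integral_finite_count hQ mB lB).
- apply/measurable_EFinP; apply: measurable_funM; last exact: (tempered_poly pP).1.
  have mz := (tempered_poly zP).1.
  by apply: measurable_funB => //; exact: (measurable_shift x mz).
- by apply/measurable_EFinP; exact: (tempered_poly sP).1.
move=> mu muB; rewrite cells_add_point//.
by rewrite (_ : kappa x = j)// chaos_difference.
Qed.

(** By duality of I_{n+1}(h) with itself, its second moment is the sum over j and
    over the n + 1 insertions of l_j E I_n(h') I_n(h_j), where h' has j inserted.
    Both factors have, after summation over j, the norm of h, and
    2 I I' <= I^2 + I'^2 replaces the Cauchy-Schwarz inequality. Equality holds
    for symmetric kernels. *)
Lemma chaos_second_moment n h :
  \int[Q]_mu (chaos S l n h (cells mu) ^+ 2)%:E <=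
  (n`!%:R * sqnorm S l n h)%:E.
Proof.
have zP := chaos_polynomial S l.
have z2P n' h' : polynomial_in_cells S (fun c => chaos S l n' h' c ^+ 2)%R.
  by have := cell_polyM (zP n' h') (zP n' h'); congr polynomial_in_cells.
rewrite (E_EFin (z2P n h)) lee_fin; elim: n h => [|n IH] h.
  rewrite /E /chaos fact0 mul1r /sqnorm.
  rewrite Rintegral_cst// [X in fine X](_ : _ = 1) ?mulr1//.
  exact: probability_setT.
have l0 j : (0 <= l j)%R by exact: fine_ge0.
have aP j : j \in S -> polynomial_in_cells S (fun c => chaos S l n.+1 h c *
    (c j * chaos S l n (slice j h) (sub_cell j c)
     - l j * chaos S l n (slice j h) c))%R.
  by move=> jS; apply: cell_polyM => //; exact: (cell_poly_adjoint l jS (zP _ _)).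
have -> : E (fun c => chaos S l n.+1 h c ^+ 2)%R =
    E (fun c => \sum_(j in S) chaos S l n.+1 h c *
      (c j * chaos S l n (slice j h) (sub_cell j c)
       - l j * chaos S l n (slice j h) c))%R.
  by congr E; apply/funext => c; rewrite -mulr_sumr -chaosS.
rewrite E_sum//.
under eq_bigr => j jS do rewrite E_cell_adjoint//.
apply: (@le_trans _ _ (\sum_(j in S) l j * \sum_(r < n.+1)
   (n`!%:R / 2 * (sqnorm S l n (insert_at r j h) + sqnorm S l n (slice j h))))%R).
  apply: ler_sum => j jS; apply: ler_wpM2l => //.
  have hP r : polynomial_in_cells S (fun c => 2^-1 *
      (chaos S l n (insert_at r j h) c ^+ 2 + chaos S l n (slice j h) c ^+ 2))%R.
    by apply: cell_polyM; [exact: cell_poly_cst|exact: cell_polyD].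
  apply: (@le_trans _ _ (E (fun c => \sum_(r in 'I_n.+1) 2^-1 *
      (chaos S l n (insert_at r j h) c ^+ 2 + chaos S l n (slice j h) c ^+ 2))%R)).
    apply: E_le.
    - by apply: cell_polyM => //; apply: cell_poly_sum.
    - exact: cell_poly_sum.
    move=> c; rewrite mulr_suml; apply: ler_sum => r _.
    have := sqr_ge0 (chaos S l n (insert_at r j h) c - chaos S l n (slice j h) c)%R.
    set a := chaos _ _ _ (insert_at r j h) _; set b := chaos _ _ _ _ _.
    by nra.
  rewrite E_sum//; apply: ler_sum => r _.
  rewrite EZ; last exact: cell_polyD.
  rewrite ED// mulrAC mulrC ler_wpM2r// mulrDr lerD//.
under eq_bigr => j _ do rewrite mulr_sumr.
rewrite exchange_big /=.
apply: (@le_trans _ _ (\sum_(r < n.+1) n`!%:R * sqnorm S l n.+1 h)%R); last first.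
  by rewrite sumr_const card_ord factS natrM -mulrA -[leLHS]mulr_natl lexx.
apply: ler_sum => r _; rewrite le_eqVlt; apply/orP; left; apply/eqP.
transitivity (n`!%:R / 2 * (\sum_(j in S) l j * sqnorm S l n (insert_at r j h) +
  \sum_(j in S) l j * sqnorm S l n (slice j h)))%R.
  rewrite -big_split mulr_sumr /=; apply: eq_bigr => j _; ring.
rewrite (sqnorm_insert_at S l h (r := r))// ?leq_ord// -sqnormS.
by field.
Qed.

Lemma integral_sqnorm n h : supported h ->
  \int[power_measure lambda n]_t ((h (map kappa t)) ^+ 2)%:E =
  (sqnorm S l n h)%:E.
Proof.
elim: n h => [|n IH] h hS; first by rewrite integral_power0.
rewrite ge0_integral_powerS; last 2 first.
- apply/measurable_EFinP; apply: measurable_funX; exact: measurable_grid.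
- by move=> t; rewrite lee_fin sqr_ge0.
rewrite (eq_integral (fun x => \sum_(j in S)
    ((cst (sqnorm S l n (slice j h))%:E) \_ (cell j)) x)); last first.
  move=> x _; rewrite patch_cell_sum.
  have -> : \int[power_measure lambda n]_t
        ((h (map kappa (tuple_cons (x, t)))) ^+ 2)%:E =
      (sqnorm S l n (slice (kappa x) h))%:E by rewrite -IH//; exact: supported_slice.
  case: ifPn => // kS; rewrite slice_out//; congr EFin.
  elim: {IH} n => [|n IH]; first by rewrite /sqnorm expr0n.
  by rewrite sqnormS big1// => j _; rewrite -[slice j _]/(fun=> 0%R) IH mulr0.
rewrite -integral_cells; last first.
  move=> j jS; apply/integrableP; split => //.
  by rewrite integral_cst// lte_mul_pinfty// ?lcell// lee_fin normr_ge0.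
rewrite sqnormS -sumEFin; apply: eq_bigr => j jS.
by rewrite integral_cst// EFinM -lcellE// muleC.
Qed.

(** The inequality 0 <= E (f - a Z)^2, expanded for the multiple integral Z of an
    indicator: the mixed term is given by chaos_duality, and the last one by
    chaos_second_moment. *)
Lemma grid_variance_bound n f (A : pred (seq T)) (a : R) : tempered f ->
  \int[Q]_mu (f mu ^+ 2)%:E < +oo ->
  \int[power_measure lambda n]_(t in box B n `&` [set t | A (map kappa t)])
     (2 * a * fine (mean_diff Q f t) - a ^+ 2 * n`!%:R)%:E <=
  \int[Q]_mu (f mu ^+ 2)%:E.
Proof.
move=> fT f2oo; have mf := fT.1.
set D := box B n `&` [set t | A (map kappa t)].
(* The indicator of D, as a function of the cells. *)
pose h (s : seq T) : R := (all [in S] s && A s)%:R.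
have hS : supported h by move=> s /negbTE sS; rewrite /h sS.
have hE (t : n.-tuple X) :
    h (map kappa t) = \1_D t.
  rewrite /h indicE; congr (_%:R); congr nat_of_bool.
  apply/idP/idP => [/andP[/allP tS At]|/set_mem [tB At]].
    by apply/mem_set; split => // i; apply: tS; rewrite map_f// mem_tnth.
  apply/andP; split => //; apply/allP => _ /mapP[x /tnthP[i ->] ->]; exact: tB.
have mD : measurable D.
  apply: measurableI; first exact: measurable_box.
  have := @measurable_grid n (fun s => (A s)%:R) measurableT _ (measurable_set1 1%R).
  rewrite setTI; congr measurable; apply/seteqP; split => t /=.
    by case: (A _) => // /eqP; rewrite eq_sym oner_eq0.
  by move=> ->.
have lD : power_measure lambda n D =
    (sqnorm S l n h)%:E.
  rewrite -integral_sqnorm//.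
  transitivity (\int[power_measure lambda n]_t
      (\1_D t : R)%:E).
    by rewrite integral_indic// setIT.
  apply: eq_integral => t _; rewrite -hE /h.
  by case: (_ && _); rewrite ?expr1n ?expr0n.
pose Z mu := chaos S l n h (cells mu).
have zP := chaos_polynomial S l n h.
have ZT : tempered Z := tempered_poly zP.
have fZT : tempered (fun mu => f mu * Z mu)%R := tempered_polynomial fT zP.
have Z2P : polynomial_in_cells S (fun c => chaos S l n h c ^+ 2)%R.
  by have := cell_polyM zP zP; congr polynomial_in_cells.
have iZ2 : Q.-integrable setT (fun mu => (Z mu ^+ 2)%:E) := integrable_poly Z2P.
have ifZ : Q.-integrable setT (fun mu => (f mu * Z mu)%:E) := tempered_integrable fZT.
have if2 : Q.-integrable setT (fun mu => (f mu ^+ 2)%:E).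
  apply/integrableP; split; first by apply/measurable_EFinP; exact: measurable_funX.
  by under eq_integral do rewrite /= ger0_norm ?sqr_ge0//.
pose If2 := (\int[Q]_mu (f mu ^+ 2))%R.
pose IfZ := (\int[Q]_mu (f mu * Z mu))%R.
pose IZ2 := (\int[Q]_mu (Z mu ^+ 2))%R.
have If2E : \int[Q]_mu (f mu ^+ 2)%:E = If2%:E.
  by rewrite /If2 /Rintegral fineK//; exact: integrable_fin_num if2.
have IfZE : \int[Q]_mu (f mu * Z mu)%:E = IfZ%:E.
  by rewrite /IfZ /Rintegral fineK//; exact: integrable_fin_num ifZ.
have IZ2E : \int[Q]_mu (Z mu ^+ 2)%:E = IZ2%:E.
  by rewrite /IZ2 /Rintegral fineK//; exact: integrable_fin_num iZ2.
have IZ2le : (IZ2 <= n`!%:R * sqnorm S l n h)%R.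
  by rewrite -lee_fin -IZ2E; exact: chaos_second_moment.
(* This is 0 <= E (f - a Z)^2, with the square expanded. *)
have key : (0 <= If2 + (- (2 * a)) * IfZ + a ^+ 2 * IZ2)%R.
  rewrite -RintegralZl// -RintegralZl// -RintegralD//; last first.
    by have := integrableZl measurableT (- (2 * a)) ifZ; exact.
  rewrite -RintegralD//; last 2 first.
  - have := integrableD measurableT if2 (integrableZl measurableT (- (2 * a)) ifZ).
    exact.
  - by have := integrableZl measurableT (a ^+ 2) iZ2; exact.
  apply: Rintegral_ge0 => mu _.
  have := sqr_ge0 (f mu - a * Z mu); nra.
rewrite If2E.
have intu : (power_measure lambda n).-integrable D
    (fun t : n.-tuple X => mean_diff Q f t).
  apply: integrableS (integrable_mean_diff hQ mB lB n fT) => //.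
    exact: measurable_box.
  exact: subIsetl.
have miu := measurable_int _ intu.
have aeu := integrable_ae mD intu.
have uE : \int[power_measure lambda n]_(t in D)
    (fine (mean_diff Q f t))%:E = IfZ%:E.
  rewrite -IfZE chaos_duality//.
  transitivity (\int[power_measure lambda n]_(t in D)
     mean_diff Q f t).
    apply: ae_eq_integral => //.
    - apply/measurable_EFinP; apply: measurable_funTS.
      apply: (measurableT_comp (fine_measurable _)) => //.
      exact: measurable_mean_diff.
    - by apply: filterS aeu => t h' Dt; rewrite fineK// h'.
  rewrite integral_mkcond; apply: eq_integral => t _.
  by rewrite epatch_indic hE muleC.
have iuf : (power_measure lambda n).-integrable
    D
    (EFin \o (fun t : n.-tuple X => fine (mean_diff Q f t))).
  apply: (le_integrable mD _ _ intu) => //.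
    apply/measurable_EFinP; apply: measurable_funTS.
    apply: (measurableT_comp (fine_measurable _)) => //.
    exact: measurable_mean_diff.
  move=> t _ /=; case: (mean_diff Q f t) => [r| |] //=; by rewrite normr0 leey.
rewrite integralB_EFin//; last 2 first.
- by have := integrableZl mD (2 * a) iuf; exact.
- apply/integrableP; split; first exact: measurable_cst.
  rewrite (eq_integral (cst `|(a ^+ 2 * n`!%:R)%:E|))// integral_cst//.
  apply: lte_mul_pinfty => //.
  have : (sqnorm S l n h)%:E < +oo by exact: ltry.
  by rewrite -lD.
have uE2 : \int[power_measure lambda n]_(t in D)
    (2 * a * fine (mean_diff Q f t))%:E = (2 * a * IfZ)%:E.
  by under eq_integral do rewrite EFinM; rewrite integralZl// uE.
have cE : \int[power_measure lambda n]_(t in D) (a ^+ 2 * n`!%:R)%:E =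
    (a ^+ 2 * n`!%:R * sqnorm S l n h)%:E.
  transitivity ((a ^+ 2 * n`!%:R)%:E * power_measure lambda n D).
    exact: (@integral_cst _ _ _ (power_measure lambda n) D mD).
  by rewrite [X in _ * X](_ : _ = (sqnorm S l n h)%:E).
rewrite uE2 [X in _ - X](_ : _ = (a ^+ 2 * n`!%:R * sqnorm S l n h)%:E);
  last exact: cE.
rewrite -EFinB lee_fin.
have := ler_wpM2l (sqr_ge0 a) IZ2le; lra.
Qed.

End grid_chaos.

(** * The variance bound for one mean difference *)

Section grid_algebra.
Local Open Scope ereal_scope.
Context d (X : measurableType d) (R : realType).

(** The sets of tuples that are unions of products of cells of one finite
    partition. They form an algebra because partitions can be refined. *)
Definition grid_sets n : set (set (n.-tuple X)) := [set G |
  exists (T : finType) (kappa : X -> T) (A : pred (seq T)),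
    measurable_cells kappa /\ G = [set t : n.-tuple X | A (map kappa t)]].
Arguments grid_sets : clear implicits.

Lemma grid_setsT n : grid_sets n setT.
Proof.
exists unit, (fun _ => tt), xpredT; split; last by apply/seteqP; split.
by move=> []; rewrite (_ : _ @^-1` _ = setT)//; apply/seteqP; split.
Qed.

Lemma grid_setsC n : setC_closed (grid_sets n).
Proof.
move=> _ [T [kappa [A [mk ->]]]]; exists T, kappa, (fun s => ~~ A s); split => //.
by apply/seteqP; split => t /= /negP.
Qed.

Lemma grid_setsU n : setU_closed (grid_sets n).
Proof.
move=> _ _ [T [k [A [mk ->]]]] [T' [k' [A' [mk' ->]]]].
exists _, (fun x => (k x, k' x)), (fun s => A (map fst s) || A' (map snd s)).
split; first exact: measurable_cells_pair.
apply/seteqP; split => t /=; rewrite -!map_comp.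
  by case => h; apply/orP; [left|right].
by case/orP; [left|right].
Qed.

Lemma measurable_grid_sets n : grid_sets n `<=` measurable.
Proof.
move=> _ [T [k [A [mk ->]]]].
have := measurable_grid mk (fun s => (A s)%:R : R) (n := n) measurableT
  (measurable_set1 1%R).
rewrite setTI; congr measurable; apply/seteqP; split => t /=.
  by case: (A _) => // /eqP; rewrite eq_sym oner_eq0.
by move=> ->.
Qed.

Lemma measurable_tuple_grid n (W : set (n.-tuple X)) :
  measurable W -> <<s grid_sets n >> W.
Proof.
apply: sub_sigma_algebra2 => {}W; apply: (big_ind (fun H => H W -> grid_sets n W)).
- by case.
- by move=> H1 H2 h1 h2 [/h1|/h2].
move=> i _ [C mC <-] /=.
exists bool, (fun x => x \in C), (fun s => nth false s i); split.
  exact: measurable_cells_mem.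
apply/seteqP; split => t /=; rewrite (nth_map (tnth t i)) ?size_tuple// -tnth_nth.
  by move=> [_ /mem_set].
by move=> /set_mem.
Qed.

End grid_algebra.
Arguments grid_sets {d X} n _.

Section variance_bound.
Local Open Scope ereal_scope.
Context d (X : measurableType d) (R : realType).
Local Notation N := (point_measure X R).
Variables (lambda : {sigma_finite_measure set X -> \bar R}) (Q : probability N R).
Hypothesis hQ : poisson_counts lambda Q.
Variable f : N -> R.
Hypotheses (mf : measurable_fun setT f) (f2oo : \int[Q]_mu (f mu ^+ 2)%:E < +oo).

Section box.
Variables (B : set X) (n : nat) (a : R).
Hypotheses (mB : measurable B) (lB : lambda B < +oo).
(** The integrand of grid_variance_bound. *)
Let v (t : n.-tuple X) : R := (2 * a * fine (mean_diff Q f t) - a ^+ 2 * n`!%:R)%R.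

Let fT : tempered Q B f. Proof. exact: (tempered_L2 hQ mB lB). Qed.

Let mu_fine : measurable_fun setT (fun t : n.-tuple X => fine (mean_diff Q f t)).
Proof.
by apply: (measurableT_comp (fine_measurable _)) => //; exact: measurable_mean_diff.
Qed.

Let mv : measurable_fun setT v.
Proof.
apply: measurable_funB => //.
by apply: measurable_funM.
Qed.

Let iv : (power_measure lambda n).-integrable (box B n) (EFin \o v).
Proof.
have mbox := @measurable_box _ X B mB n.
have iu := integrable_mean_diff hQ mB lB n fT.
have iuf : (power_measure lambda n).-integrable (box B n)
    (EFin \o (fun t : n.-tuple X => fine (mean_diff Q f t))).
  apply: (le_integrable mbox _ _ iu) => //.
    by apply/measurable_EFinP; apply: measurable_funTS.
  by move=> t _ /=; case: (mean_diff Q f t) => [r| |] //=; rewrite normr0 leey.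
have := integrableB mbox (integrableZl mbox (2 * a) iuf).
move=> /(_ (cst (a ^+ 2 * n`!%:R)%:E)); apply.
apply/integrableP; split; first exact: measurable_cst.
rewrite (eq_integral (cst `|(a ^+ 2 * n`!%:R)%:E|))// integral_cst//.
apply: lte_mul_pinfty => //.
rewrite [X in X < _](power_measure_box lambda mB n).
have lBf : lambda B = (fine (lambda B))%:E by rewrite fineK// ge0_fin_numE.
by under eq_bigr do rewrite lBf; rewrite prodEFin ltry.
Qed.

(** B is made a union of cells by recording membership in B in the label. *)
Lemma grid_set_bound G : grid_sets n G ->
  \int[power_measure lambda n]_(t in box B n `&` G) (v t)%:E <=
  \int[Q]_mu (f mu ^+ 2)%:E.
Proof.
move=> [T [k [A [mk ->]]]].
pose k' x := (k x, x \in B).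
have mk' : measurable_cells k'.
  by apply: measurable_cells_pair => //; exact: measurable_cells_mem.
pose S : {pred T * bool} := [pred p | p.2].
have BE : k' @^-1` [set` S] = B.
  by apply/seteqP; split => x; [exact: set_mem|exact: mem_set].
have := @grid_variance_bound _ _ _ _ _ hQ _ k' S mk'.
rewrite BE => /(_ lB n f (fun s => A (map fst s)) a fT f2oo).
rewrite (_ : [set t | A (map fst (map k' t))] = [set t | A (map k t)])//.
by apply/funext => t /=; rewrite -map_comp.
Qed.

(** W is approximated by grid sets in the measure with density |v| on the box,
    which bounds the change of the integral of v. *)
Lemma box_variance_bound W : measurable W -> W `<=` box B n ->
  \int[power_measure lambda n]_(t in W) (v t)%:E <= \int[Q]_mu (f mu ^+ 2)%:E.
Proof.
move=> mW WB; set lam := power_measure lambda n.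
have mbox := @measurable_box _ X B mB n.
pose w t := (abse \o (EFin \o v)) \_ (box B n) t.
have mw : measurable_fun setT w.
  apply/(measurable_restrictT _ mbox); apply: measurable_funTS.
  by apply: measurableT_comp => //; exact/measurable_EFinP.
have w0 t : 0 <= w t by rewrite /w patchE; case: ifP => _; rewrite ?abse_ge0.
pose nu : {measure set (n.-tuple X) -> \bar R} := weighted lam mw w0.
have nuT : nu setT < +oo.
  have /integrableP[_] := iv.
  by rewrite integral_mkcond.
have [_ Wapp] := g_sigma_algebra_approximable nuT (@measurable_grid_sets _ X R n)
  (@grid_setsT _ X n) (@grid_setsC _ X n) (@grid_setsU _ X n)
  (measurable_tuple_grid mW).
apply/lee_addgt0Pr => e /Wapp[G gG nuWG].
have mG := measurable_grid_sets R gG.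
apply: (@le_trans _ _ (\int[lam]_(t in box B n `&` G) (v t)%:E + nu (W `+` G))); last first.
  by rewrite leeD// ?grid_set_bound// ltW.
have mY : measurable (W `+` G) by apply: measurableU; apply: measurableD.
have mBG : measurable (box B n `&` G) by apply: measurableI.
have iW : lam.-integrable setT ((EFin \o v) \_ W).
  by apply/(integrable_mkcond _ mW); exact: integrableS iv.
have iG : lam.-integrable setT ((EFin \o v) \_ (box B n `&` G)).
  by apply/(integrable_mkcond _ mBG); apply: integrableS iv => //; exact: subIsetl.
have iY : lam.-integrable setT (w \_ (W `+` G)).
  apply/(integrable_mkcond _ mY).
  apply: (@integrableS _ _ _ _ setT) => //.
  apply/(integrable_mkcond _ mbox).
  exact: integrable_abse.
rewrite [X in _ <= _ + X](_ : _ = \int[lam]_t (w \_ (W `+` G)) t); last first.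
  by rewrite -integral_mkcond.
rewrite integral_mkcond [X in _ <= X + _]integral_mkcond -integralD//.
apply: le_integral => //; first exact: integrableD.
move=> t _; rewrite /w !patchE.
have [tW|tW] := boolP (t \in W).
  have tB : t \in box B n by apply/mem_set/WB/set_mem.
  have [tG|tG] := boolP (t \in G).
    rewrite in_setI tB tG/= leeDl//.
    by case: ifP.
  rewrite in_setI tB (negbTE tG)/= add0e ifT ?lee_fin ?ler_norm//.
  by apply/mem_set; left; split; [exact: set_mem|move/mem_set; apply/negP].
have [tG|tG] := boolP (t \in G).
  rewrite [t \in W `+` G](_ : _ = true); last first.
    by apply/mem_set; right; split; [exact: set_mem|move/mem_set; apply/negP].
  rewrite in_setI tG andbT; case: ifP => _; last by rewrite add0e.
  by rewrite /= -EFinD lee_fin -lerBlDl sub0r ler_normr lexx orbT.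
by rewrite in_setI (negbTE tG) andbF add0e; case: ifP => // _; case: ifP => // _; exact: abse_ge0.
Qed.

End box.

(** The choice a = s c / n! maximizes 2 a s c - a^2 n!, with value c^2 / n!. *)
Lemma box_level_bound B n (c s : R) W : measurable B -> lambda B < +oo ->
  (0 <= c)%R -> (s ^+ 2 = 1)%R -> measurable W -> W `<=` box B n ->
  (forall t, W t -> (c <= s * fine (mean_diff Q f t))%R) ->
  (c ^+ 2 / n`!%:R)%:E * power_measure lambda n W <= \int[Q]_mu (f mu ^+ 2)%:E.
Proof.
move=> mB lB c0 s1 mW WB Wc.
have n0 : (0 < (n`!%:R)^-1 :> R)%R by rewrite invr_gt0 ltr0n fact_gt0.
have nn : ((n`!%:R)^-1 * n`!%:R = 1 :> R)%R.
  by rewrite mulVf// pnatr_eq0 -lt0n fact_gt0.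
apply: le_trans (box_variance_bound (s * c / n`!%:R) mB lB mW WB).
(* With a = s c / n!, the bound s u >= c makes the integrand at least c^2 / n!. *)
have vc t : W t -> (c ^+ 2 / n`!%:R <=
    2 * (s * c / n`!%:R) * fine (mean_diff Q f t) -
    (s * c / n`!%:R) ^+ 2 * n`!%:R)%R.
  move=> /Wc; move: (fine _) => u cu.
  set q := (n`!%:R)^-1%R in n0 nn *.
  rewrite (_ : (s * c * q) ^+ 2 * n`!%:R = s ^+ 2 * c ^+ 2 * q * (q * n`!%:R))%R; last by ring.
  rewrite s1 nn mul1r mulr1.
  rewrite (_ : 2 * (s * c * q) * u = (2 * q) * (c * (s * u)))%R; last by ring.
  by have := ler_wpM2l c0 cu; nra.
rewrite -(integral_cst (power_measure lambda n) mW).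
apply: ge0_le_integral => //.
- by move=> t _; rewrite lee_fin divr_ge0// sqr_ge0.
- apply/measurable_EFinP; apply: measurable_funTS; apply: measurable_funB => //.
  apply: measurable_funM => //; apply: (measurableT_comp (fine_measurable _)) => //.
  exact: measurable_mean_diff.
Qed.

Lemma level_bound n (c s : R) W : (0 <= c)%R -> (s ^+ 2 = 1)%R -> measurable W ->
  (forall t : n.-tuple X, W t -> (c <= s * fine (mean_diff Q f t))%R) ->
  (c ^+ 2 / n`!%:R)%:E * power_measure lambda n W <= \int[Q]_mu (f mu ^+ 2)%:E.
Proof.
move=> c0 s1 mW Wc.
have /sigma_finiteP[B [TB ndB Boo]] := sigma_finiteT lambda.
pose V i := W `&` box (B i) n.
have mV i : measurable (V i).
  by apply: measurableI => //; apply: measurable_box; exact: (Boo i).1.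
have VE : \bigcup_i V i = W.
  by rewrite /V -setI_bigcupr bigcup_box// setIT.
have ndV : {homo V : i j / (i <= j)%N >-> (i <= j)%O}.
  move=> i j ij; apply/subsetPset; apply: setIS => t ti l.
  by have /subsetPset := ndB _ _ ij; apply.
have := nondecreasing_cvg_mu (mu := power_measure lambda n) mV.
rewrite VE => /(_ mW ndV) cV.
have cVc : ((c ^+ 2 / n`!%:R)%:E * (power_measure lambda n (V i))) @[i --> \oo] -->
    (c ^+ 2 / n`!%:R)%:E * power_measure lambda n W by exact: cvgeZl.
rewrite -(cvg_lim _ cVc)//; apply: lime_le.
  apply/cvg_ex.
  by exists ((c ^+ 2 / n`!%:R)%:E * power_measure lambda n W).
apply: nearW => i; apply: (box_level_bound _ (Boo i).2 c0 s1) => //.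
- exact: (Boo i).1.
- exact: subIsetr.
- by move=> t [Wt _]; exact: Wc.
Qed.

End variance_bound.

Section centered_variance_bound.
Local Open Scope ereal_scope.
Context d (X : measurableType d) (R : realType).
Local Notation N := (point_measure X R).
Variables (lambda : {sigma_finite_measure set X -> \bar R}) (Q : probability N R).
Hypothesis hQ : poisson_counts lambda Q.

(** Differences of positive order do not see constants. *)
Lemma centered_level_bound (f : N -> R) (m : R) n (c s : R) W :
  measurable_fun setT f -> \int[Q]_mu ((f mu - m) ^+ 2)%:E < +oo ->
  (0 < n)%N -> (0 <= c)%R -> (s ^+ 2 = 1)%R -> measurable W ->
  (forall t : n.-tuple X, W t -> (c <= s * fine (mean_diff Q f t))%R) ->
  (c ^+ 2 / n`!%:R)%:E * power_measure lambda n W <=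
    \int[Q]_mu ((f mu - m) ^+ 2)%:E.
Proof.
move=> mf f2 n0 c0 s1 mW Wc.
apply: (level_bound hQ _ f2 c0 s1 mW); first exact: measurable_funB.
move=> t /Wc; rewrite /mean_diff => /le_trans; apply.
by under [X in (_ <= _ * fine X)%R]eq_integral do rewrite diff_subr_cst ?size_tuple//.
Qed.

End centered_variance_bound.

(** * From the probability space to the law of the process *)

Section transfer_to_law.
Local Open Scope ereal_scope.
Context d d' (X : measurableType d) (Omega : measurableType d') (R : realType).
Local Notation N := (point_measure X R).
Variables (P : probability Omega R) (lambda : {sigma_finite_measure set X -> \bar R}).
Variable eta : {mfun Omega >-> N}.
Local Notation Q := (distribution P eta).

Lemma poisson_process_counts :
  poisson_process P lambda eta -> poisson_counts lambda Q.
Proof.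
move=> [marginal indep] n B A mB tB mA.
transitivity (P (\bigcap_(i in [set: 'I_n]) ((fun w => eta w (B i)) @^-1` A i))).
  congr (P _); apply/seteqP; split => [w h i _|w h i]; first exact: h.
  exact: (h i).
rewrite indep//; apply: eq_bigr => i _.
exact: marginal.
Qed.

Lemma variance_of_representative (F : {RV P >-> R}) (f : {mfun N >-> R}) :
  {ae P, forall w, F w = f (eta w)} ->
  'V_P[F] = \int[Q]_mu ((f mu - fine 'E_P[F]) ^+ 2)%:E.
Proof.
move=> Ff; set m := fine _.
have mfm : measurable_fun setT (fun mu => ((f mu - m) ^+ 2)%:E).
  by apply/measurable_EFinP; apply: measurable_funX; exact: measurable_funB.
rewrite ge0_integral_distribution//; last by move=> y; rewrite lee_fin sqr_ge0.
rewrite /variance covariance.unlock -/m expectation.unlock.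
apply: ae_eq_integral => //.
- apply/measurable_EFinP; apply: measurable_funM; exact: measurable_funB.
- exact: measurableT_comp mfm _.
by apply: filterS Ff => w Fw _; rewrite /= /GRing.mul/= expr2 Fw.
Qed.

Lemma representative_L2 (F : {RV P >-> R}) (f : {mfun N >-> R}) :
  (F : Omega -> R) \in Lfun P 2%:E -> {ae P, forall w, F w = f (eta w)} ->
  \int[Q]_mu (f mu ^+ 2)%:E < +oo.
Proof.
move=> F2 Ff.
have mf2 : measurable_fun setT (fun mu => (f mu ^+ 2)%:E).
  by apply/measurable_EFinP; exact: measurable_funX.
rewrite ge0_integral_distribution//; last by move=> y; rewrite lee_fin sqr_ge0.
have /integrableP[_] := Lfun2_integrable_sqr F2; congr (_ < _).
apply: ae_eq_integral => //.
- by apply: measurableT_comp => //; apply/measurable_EFinP; exact: measurable_funX.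
- exact: measurableT_comp mf2 _.
by apply: filterS Ff => w /= -> _; rewrite ger0_norm ?sqr_ge0.
Qed.

End transfer_to_law.

(** * Choosing a set of coordinates and a sign *)

Section pointwise_expansion.
Local Open Scope ereal_scope.
Context d (X : measurableType d) (R : realType).
Local Notation N := (point_measure X R).
Variables (lambda : {sigma_finite_measure set X -> \bar R}) (Q : probability N R).
Hypothesis hQ : poisson_counts lambda Q.
Variable f : N -> R.
Hypotheses (mf : measurable_fun setT f) (f2oo : \int[Q]_mu (f mu ^+ 2)%:E < +oo).

(** Where it is finite, every difference of f in some of the points of x is
    integrable. *)
Definition mean_envelope n (x : n.-tuple X) :=
  \int[Q]_mu (envelope (fun mu => `|f mu|%R) x mu)%:E.

Lemma ae_finite_mean_envelope n :
  {ae power_measure lambda n, forall x, mean_envelope x < +oo}.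
Proof.
have /sigma_finiteP[B [TB ndB Boo]] := sigma_finiteT lambda.
have : forall i, {ae power_measure lambda n, forall x,
    box (B i) n x -> mean_envelope x \is a fin_num}.
  move=> i; have [mB lB] := Boo i.
  apply: integrable_ae; first exact: measurable_box.
  exact: (integrable_mean_envelope hQ mB lB n (tempered_L2 hQ mB lB mf f2oo)).
move=> /ae_foralln; apply: filterS => x h.
have : setT x by [].
rewrite -(bigcup_box n ndB (esym TB)) => -[i _ /(h i)].
by rewrite fin_numE => /andP[_]; rewrite ltey.
Qed.

Section at_a_point.
Variables (k : nat) (x : k.-tuple X).
Hypothesis xfin : mean_envelope x < +oo.
Local Notation sub J := (map (tnth x) (enum J)).

Lemma integrable_diff_sub (J : {set 'I_k}) :
  Q.-integrable setT (fun mu => (diff f (sub J) mu)%:E).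
Proof.
have mdiff (s : seq X) : measurable_fun setT (diff f s).
  exact: (@measurable_diff _ _ _ f (size s) _ N id (fun _ => in_tuple s)).
apply/integrableP; split; first by apply/measurable_EFinP; exact: mdiff.
apply: le_lt_trans xfin; apply: ge0_le_integral => //.
- by apply: measurableT_comp => //; apply/measurable_EFinP; exact: mdiff.
- apply/measurable_EFinP.
  apply: (@measurable_envelope _ _ _ _ k _ N id (fun _ => x)) => //.
  exact: measurableT_comp.
move=> mu _; rewrite /= lee_fin; apply: le_trans (normr_diff_le _ _ _) _.
apply: le_envelope_subseq => //.
have -> : (x : seq X) = map (tnth x) (enum 'I_k).
  by rewrite -[LHS]map_tnth_enum.
by apply: map_subseq; rewrite [X in subseq _ X]enumT; exact: filter_subseq.
Qed.

Lemma mean_diff_fin_num (J : {set 'I_k}) : mean_diff Q f (sub J) \is a fin_num.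
Proof. exact: integrable_fin_num (integrable_diff_sub J). Qed.

(** The difference of the two expansions over subsets has coefficients -1, 0 or 1,
    and 0 at the empty set. If all 2^k - 1 remaining means were smaller than
    c / 2^k in absolute value, their sum would be smaller than c. *)
Lemma exists_large_mean_diff (I1 I2 : {set 'I_k}) (c : R) : (0 < c)%R ->
  c%:E <= `|\int[Q]_mu (f (mu + \sum_(i in I1) pm_dirac (tnth x i)) -
                        f (mu + \sum_(i in I2) pm_dirac (tnth x i)))%:E| ->
  exists2 J : {set 'I_k}, J != finset.set0 &
    (c / 2 ^+ k <= `|fine (mean_diff Q f (sub J))|)%R.
Proof.
move=> c0.
(* J contributes to the first, the second, both or none of the expansions. *)
pose coef (J : {set 'I_k}) : R := ((J \subset I1)%:R - (J \subset I2)%:R)%R.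
have coef1 J : (`|coef J| <= 1)%R.
  by rewrite /coef; case: (_ \subset _); case: (_ \subset _);
    rewrite ?subrr ?subr0 ?sub0r ?normrN ?normr0 ?normr1.
under eq_integral.
  move=> mu _; rewrite !set_superposition_expansion.
  rewrite (_ : (_ - _)%R = \sum_(J in [set~ finset.set0]%SET)
      coef J * diff f (sub J) mu)%R; last first.
    rewrite [X in (X - _)%R]big_mkcond [X in (_ - X)%R]big_mkcond -sumrB /=.
    rewrite (bigD1 finset.set0)//= !finset.sub0set subrr add0r.
    apply: eq_big => [J|J _]; first by rewrite !inE.
    by rewrite /coef mulrBl; do 2!case: (_ \subset _); rewrite ?mul1r ?mul0r.
  rewrite -sumEFin.
  over.
rewrite integral_sum_in; last first.
  by move=> J _; have := integrableZl measurableT (coef J) (integrable_diff_sub J).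
under eq_bigr.
  move=> J _.
  rewrite (_ : \int[Q]_mu (coef J * diff f (sub J) mu)%:E =
     (coef J * fine (mean_diff Q f (sub J)))%:E); last first.
    rewrite EFinM fineK ?mean_diff_fin_num//.
    by rewrite /mean_diff -integralZl//; exact: integrable_diff_sub.
  over.
rewrite sumEFin lee_fin => le_c; apply: contrapT => nJ.
have lt_J (J : {set 'I_k}) : J != finset.set0 ->
    (`|fine (mean_diff Q f (sub J))| < c / 2 ^+ k)%R.
  by move=> J0; rewrite ltNge; apply/negP => ?; apply: nJ; exists J.
have : (c <= \sum_(J in [set~ finset.set0 : {set 'I_k}]%SET) c / 2 ^+ k)%R.
  apply: le_trans le_c _; apply: le_trans (ler_norm_sum _ _ _) _.
  apply: ler_sum => J; rewrite !inE => /lt_J/ltW; apply: le_trans.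
  by rewrite normrM ler_piMl.
rewrite sumr_const cardsC1 -cardsT -finset.powersetT card_powerset cardsT card_ord.
rewrite -[X in (_ <= X)%R]mulr_natl -subn1 natrB ?expn_gt0// natrX mulrBl mul1r mulrC divfK ?expf_neq0//.
by rewrite lerBrDr gerDl leNgt divr_gt0// exprn_gt0.
Qed.

End at_a_point.
End pointwise_expansion.

Section pigeonhole.
Local Open Scope ereal_scope.
Context d (T : measurableType d) (R : realType) (mu : {measure set T -> \bar R}).

(** The largest of the V i will do, since U is covered by them up to a null
    set. *)
Lemma measure_pigeonhole (I : finType) (S : pred I) (i0 : I) (U : set T)
    (V : I -> set T) : S i0 -> measurable U -> (forall i, measurable (V i)) ->
  {ae mu, forall x, U x -> exists2 i, S i & V i x} ->
  exists2 i, S i & mu U <= #|I|%:R%:E * mu (V i).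
Proof.
move=> Si0 mU mV [A [mA A0 UA]].
pose W := \big[setU/set0]_(i | S i) V i.
have [mW muW] : measurable W /\ mu W <= \sum_(i | S i) mu (V i).
  apply: (big_ind2 (fun (Y : set T) (s : \bar R) => measurable Y /\ mu Y <= s)).
  - by rewrite measure0.
  - move=> Y1 s1 Y2 s2 [mY1 le1] [mY2 le2]; split; first exact: measurableU.
    by apply: le_trans (measureU2 _ mY1 mY2) _; exact: leeD.
  - by move=> i _.
have UAW : U `<=` A `|` W.
  move=> x Ux; rewrite /W -bigcup_pred.
  have [[i Si Vx]|nV] := pselect (exists2 i, S i & V i x).
    by right; exists i.
  by left; apply: UA => /= /(_ Ux).
exists [arg max_(i > i0 | S i) mu (V i)]%O; first by case: arg_maxP.
case: arg_maxP => // i Si maxi.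
apply: (@le_trans _ _ (mu (A `|` W))).
  by apply: le_measure; rewrite ?inE//; exact: measurableU.
apply: le_trans (measureU2 _ mA mW) _.
rewrite [X in X + _](_ : _ = 0) ?add0e; last exact: A0.
apply: le_trans muW _.
apply: (@le_trans _ _ (\sum_(j : I) mu (V i))).
  rewrite big_mkcond; apply: lee_sum => j _; case: ifP => // Sj.
  exact: maxi.
by rewrite big_const iter_addr_0 mule_natl.
Qed.

End pigeonhole.

Section projection.
Context d (X : measurableType d) (k : nat).

Lemma tuple_proj_enum (T : Type) (J : {set 'I_k}) (x : k.-tuple T) :
  tuple_proj J x = map (tnth x) (enum J) :> seq T.
Proof.
rewrite -[enum J]/(val (enum_tuple (mem J))) -[val (enum_tuple _)]map_tnth_enum.
rewrite -map_comp; apply: eq_map => i /=.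
by rewrite (tnth_nth (enum_val i)) -enum_val_nth.
Qed.

Lemma measurable_tuple_proj (J : {set 'I_k}) :
  measurable_fun setT (@tuple_proj X k J).
Proof.
apply/measurable_fun_tnthP => i.
under [X in measurable_fun _ X]eq_fun do rewrite /= tnth_mktuple.
exact: measurable_tnth.
Qed.

End projection.

Section main_bound.
Local Open Scope ereal_scope.
Context d (X : measurableType d) (R : realType).
Local Notation N := (point_measure X R).
Variables (lambda : {sigma_finite_measure set X -> \bar R}) (Q : probability N R).
Hypothesis hQ : poisson_counts lambda Q.
Variables (f : N -> R) (m : R).
Hypotheses (mf : measurable_fun setT f) (f2oo : \int[Q]_mu (f mu ^+ 2)%:E < +oo)
  (v2oo : \int[Q]_mu ((f mu - m) ^+ 2)%:E < +oo).

(** The part V of U where the pair (J, s) occurs projects into the set W where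
    s u_J >= c / 2^k; this set is measurable, while the projection of V need not
    be, and the outer measure is monotone. *)
Lemma difference_variance_bound (k : nat) (k_gt0 : (0 < k)%N) (I1 I2 : {set 'I_k})
    (U : set (k.-tuple X)) (c : R) : measurable U -> (0 < c)%R ->
  {ae power_measure lambda k, forall x, U x ->
    c%:E <= `|\int[Q]_mu (f (mu + \sum_(i in I1) pm_dirac (tnth x i)) -
                          f (mu + \sum_(i in I2) pm_dirac (tnth x i)))%:E|} ->
  exists (J : {set 'I_k}) (V : set (k.-tuple X)),
    [/\ J != finset.set0, measurable V, V `<=` U,
        power_measure lambda k U * ((2 ^+ k.+1)^-1)%:E <= power_measure lambda k V &
        (c ^+ 2 / (4 ^+ k.+1 * k`!%:R))%:E *
          mu_ext (power_measure lambda #|J|) (tuple_proj J @` V) <=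
        \int[Q]_mu ((f mu - m) ^+ 2)%:E].
Proof.
move=> mU c0 hU.
have p0 : (0 < 2 ^+ k :> R)%R by rewrite exprn_gt0.
pose a := (c / 2 ^+ k)%R.
have a0 : (0 <= a)%R by rewrite divr_ge0 ?ltW.
pose I : finType := ({set 'I_k} * bool)%type.
pose S : pred I := fun p => p.1 != finset.set0.
pose sg (p : I) : R := ((-1) ^+ p.2)%R.
pose W (p : I) : set (#|p.1|.-tuple X) :=
  [set y | (a <= sg p * fine (mean_diff Q f y))%R].
pose V p := U `&` (@tuple_proj X k p.1) @^-1` W p.
have mW p : measurable (W p).
  pose g (y : #|p.1|.-tuple X) : R := (sg p * fine (mean_diff Q f y))%R.
  have mg : measurable_fun setT g.
    apply: measurable_funM => //; apply: (measurableT_comp (fine_measurable _)) => //.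
    exact: measurable_mean_diff.
  have -> : W p = setT `&` g @^-1` `[a, +oo[.
    by rewrite setTI; apply/seteqP; split => y /=; rewrite in_itv/= andbT.
  exact: mg measurableT _ (measurable_itv _).
have mV p : measurable (V p).
  apply: measurableI => //; rewrite -[X in measurable X]setTI.
  exact: (@measurable_tuple_proj _ X k p.1 measurableT _ (mW p)).
(* Some pair exists because k > 0. *)
have S0 : S ([set: 'I_k]%SET, true).
  by apply/finset.set0Pn; exists (Ordinal k_gt0); rewrite inE.
have [|p Sp Up] := @measure_pigeonhole _ _ _ (power_measure lambda k) I S _ U V S0 mU mV.
  have fin := ae_finite_mean_envelope hQ mf f2oo k.
  apply: filterS2 hU fin => x Ux xfin xU.
  have [J J0 aJ] := exists_large_mean_diff mf xfin c0 (Ux xU).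
  (* The boolean records that u_J is negative. *)
  exists (J, (fine (mean_diff Q f (map (tnth x) (enum J))) < 0)%R) => //.
  split => //; rewrite /W /sg /= tuple_proj_enum.
  by rewrite -normrEsign.
exists p.1, (V p); split => //.
- exact: subIsetl.
- have cI : (#|I|%:R = 2 ^+ k.+1 :> R)%R.
    rewrite card_prod card_bool -cardsT -finset.powersetT card_powerset cardsT.
    by rewrite card_ord -expnSr natrX.
  have q0 : 0 <= ((2 ^+ k.+1)^-1 : R)%:E by rewrite lee_fin invr_ge0 exprn_ge0.
  apply: le_trans (lee_wpmul2r q0 Up) _.
  by rewrite muleAC -EFinM cI mulfV ?mul1e// expf_neq0.
apply: (@le_trans _ _ ((a ^+ 2 / (#|p.1|)`!%:R)%:E * power_measure lambda #|p.1| (W p))).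
  apply: lee_pmul => //.
  - by rewrite lee_fin divr_ge0 ?sqr_ge0// mulr_ge0 ?exprn_ge0.
  - exact: mu_ext_ge0.
  - have fact0 n : (0 < n`!%:R :> R)%R by rewrite ltr0n fact_gt0.
    have e0 n : (0 < 4 ^+ n :> R)%R by rewrite exprn_gt0.
    rewrite lee_fin /a expr_div_n -exprM mulnC exprM (_ : 2 ^+ 2 = 4)%R; last by ring.
    rewrite -[(c ^+ 2 / 4 ^+ k / _)%R]mulrA -invfM ler_wpM2l ?sqr_ge0// lef_pV2 ?posrE ?mulr_gt0//.
    apply: ler_pM; [exact/ltW|exact/ltW| |].
      by rewrite exprS ler_peMl ?ltW// ltr1n.
    rewrite ler_nat leq_fact//.
    by apply: leq_trans (max_card _) _; rewrite card_ord.
  - rewrite -(measurable_mu_extE _ (mW p)); apply: le_mu_ext.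
    by move=> _ [x [_ Wx] <-].
apply: (centered_level_bound (s := sg p) hQ mf v2oo) => //.
  by rewrite card_gt0.
exact: sqrr_sign.
Qed.

End main_bound.

(** * The lower bound for the variance *)

Lemma measurable_superposition d (X : measurableType d) (R : realType)
    (f : point_measure X R -> R) (I : finType) (x : I -> X) (A : {set I}) :
  measurable_fun setT f ->
  measurable_fun setT (fun mu : point_measure X R => f (mu + \sum_(i in A) pm_dirac (x i))).
Proof.
move=> mf; under eq_fun do rewrite set_superposition_expansion -big_filter.
apply: measurable_sum => J.
exact: (@measurable_diff _ _ _ f _ _ _ id (fun _ => in_tuple (map x (enum J)))).
Qed.

Theorem theorem5p2 (R : realType)
  (d d' : measure_display) (X : measurableType d) (Omega : measurableType d')
  (P : probability Omega R)
  (lambda : {sigma_finite_measure set X -> \bar R})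
  (lambda_gt0 : (0 < lambda setT)%E)
  (eta : {mfun Omega >-> point_measure X R})
  (eta_poisson : poisson_process P lambda eta)
  (F : {RV P >-> R}) (F_L2 : (F : Omega -> R) \in Lfun P 2%:E)
  (f : {mfun point_measure X R >-> R})
  (f_repr : {ae P, forall w, F w = f (eta w)})
  (k : nat) (k_gt0 : (0 < k)%N)
  (I1 I2 : {set 'I_k}) (I12 : I1 :|: I2 = [set: 'I_k]%SET)
  (U : set (k.-tuple X)) (mU : measurable U)
  (c : R) (c_gt0 : 0 < c)
  (hU : {ae power_measure lambda k, forall x, U x ->
     (c%:E <= `|'E_P[(fun w => f (eta w + \sum_(i in I1) pm_dirac (tnth x i))
                        - f (eta w + \sum_(i in I2) pm_dirac (tnth x i)))%R]|)%E}) :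
  ((c ^+ 2 / (4 ^+ k.+1 * k`!%:R))%:E *
     \big[Order.min/+oo]_(J : {set 'I_k} | J != finset.set0)
       ereal_inf [set mu_ext (power_measure lambda #|J|) (tuple_proj J @` V) |
         V in [set V : set (k.-tuple X) |
           [/\ measurable V, V `<=` U &
             (power_measure lambda k U * ((2 ^+ k.+1)^-1)%:E
                <= power_measure lambda k V)%E]]]
   <= 'V_P[F])%E.
Proof.
have hQ := poisson_process_counts eta_poisson.
have f2oo := representative_L2 F_L2 f_repr.
have VE := variance_of_representative f_repr.
have mf : measurable_fun setT f by [].
have v2oo : (\int[distribution P eta]_mu ((f mu - fine 'E_P[F]) ^+ 2)%:E < +oo)%E.
  by rewrite -VE ltey_eq variance_fin_num.
have hU' : {ae power_measure lambda k, forall x, U x ->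
    (c%:E <= `|\int[distribution P eta]_mu
       (f (mu + \sum_(i in I1) pm_dirac (tnth x i)) -
        f (mu + \sum_(i in I2) pm_dirac (tnth x i)))%:E|)%E}.
  apply: filterS hU => x hx /hx.
  rewrite expectation.unlock.
  rewrite (@integral_image_measure _ _ _ _ _ eta _ P (distribution P eta))//.
  by apply/measurable_EFinP; apply: measurable_funB; exact: measurable_superposition.
have [J [V [J0 mV VU leV bound]]] :=
  difference_variance_bound hQ mf f2oo v2oo k_gt0 mU c_gt0 hU'.
rewrite VE; apply: le_trans bound; apply: lee_wpmul2l.
  by rewrite lee_fin divr_ge0 ?sqr_ge0// mulr_ge0 ?exprn_ge0.
apply/bigmin_leP; right; exists J => //.
by apply: ereal_inf_lbound; exists V.
Qed.
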